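(* Let $T\ge 0$ and let $Y_T:\Omega\times\mathbb R^+\to\mathbb R$ be a bounded $\mathcal F_T\otimes\mathcal B(\mathbb R^+)$-measurable function; write $Y_T(\tau)$ for the random variable $\omega\mapsto Y_T(\omega,\tau(\omega))$. Then, for $t\le T$, $$\mathbb E[Y_T(\tau)\mid\mathcal G_t]=Y^{\mathrm{bd}}_t\,\mathbf 1_{\{t<\tau\}}+Y^{\mathrm{ad}}_t(T,\tau)\,\mathbf 1_{\{\tau\le t\}}\quad \mathbb P\text{-a.s.},$$ where $$Y^{\mathrm{bd}}_t=\frac{\mathbb E\big[\int_t^\infty Y_T(u)\alpha_T(u)\,\eta(du)\,\big|\,\mathcal F_t\big]}{S_t}\quad \mathbb P\text{-a.s. on } A_t=\{S_t>0\},$$ $$Y^{\mathrm{ad}}_t(T,\theta)=\frac{\mathbb E\big[Y_T(\theta)\alpha_T(\theta)\,\big|\,\mathcal F_t\big]}{\alpha_t(\theta)}\,\mathbf 1_{\{\alpha_t(\theta)>0\}}\quad \mathbb P\text{-a.s.}$$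
   Context: Let $(\Omega,\mathcal A,\mathbb P)$ be a probability space with a filtration $\mathbb F=(\mathcal F_t)_{t\ge0}$ satisfying the usual conditions (right-continuous, $\mathcal F_0$ contains all $\mathbb P$-null sets of $\mathcal A$), and let $\tau$ be a strictly positive, finite random variable (the default time). Density hypothesis (standing assumption): $\eta$ is a non-negative, non-atomic, $\sigma$-finite measure on $\mathbb R^+$ such that for every $t\ge0$ there is an $\mathcal F_t\otimes\mathcal B(\mathbb R^+)$-measurable function $(\omega,\theta)\mapsto\alpha_t(\omega,\theta)$ with $\mathbb P(\tau\in d\theta\mid\mathcal F_t)=\alpha_t(\theta)\,\eta(d\theta)$ a.s. Put $S_t:=\mathbb P(\tau>t\mid\mathcal F_t)=\int_t^\infty\alpha_t(u)\,\eta(du)$ and $A_t:=\{S_t>0\}$; up to a negligible set, $\{\tau>t\}\subset A_t$. The filtration $\mathbb G=(\mathcal G_t)_{t\ge0}$ is $\mathbb G=\mathbb F\vee\mathbb D$, where $\mathbb D=(\mathcal D_t)_{t\ge0}$ is the smallest right-continuous filtration making $\tau$ a stopping time, i.e. $\mathcal D_t=\mathcal D^0_{t+}$ with $\mathcal D^0_t=\sigma(\tau\wedge t)$. The random variable $Y^{\mathrm{ad}}_t(T,\tau)$ is $Y^{\mathrm{ad}}_t(T,\theta)$ (taken jointly measurable in $(\omega,\theta)$) evaluated at $\theta=\tau$. *)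

(* Defs.v *)
From HB Require Import structures.
From mathcomp Require Import all_boot all_order all_algebra.
From mathcomp Require Import all_classical all_reals all_analysis.

Set Implicit Arguments.
Unset Strict Implicit.
Unset Printing Implicit Defensive.

Import Order.TTheory GRing.Theory Num.Theory.
Import numFieldNormedType.Exports.

Local Open Scope classical_set_scope.
Local Open Scope ring_scope.

(* Sub-sigma-algebras are plain set systems. Time is indexed by R, but
   filtrations and densities are only constrained at times t >= 0, and
   functions on Omega x R^+ only on Omega x [0, +oo[. *)

Section conditional_expectation.
Context d (Omega : measurableType d) (R : realType).
Variable P : probability Omega R.

Definition is_condexp (G : set (set Omega)) (X Z : Omega -> R) : Prop :=
  [/\ P.-integrable setT (EFin \o X),
      measurable_fun setT (Z : g_sigma_algebraType G -> R),
      P.-integrable setT (EFin \o Z) &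
      forall A, G A ->
        (\int[P]_(w in A) (Z w)%:E = \int[P]_(w in A) (X w)%:E)%E].

(* A version of E[X | G], chosen once and for all. The default value 0 is
   relevant only when X is not integrable (or G is not a sub-sigma-algebra). *)
Definition condexp (G : set (set Omega)) (X : Omega -> R) : Omega -> R :=
  xget (cst 0) [set Z | is_condexp G X Z].

Definition condprob (G : set (set Omega)) (A : set Omega) : Omega -> R :=
  condexp G \1_A.

End conditional_expectation.

Section filtrations.
Context d (Omega : measurableType d) (R : realType).

Definition is_filtration (F : R -> set (set Omega)) : Prop :=
  [/\ forall t, 0 <= t -> sigma_algebra setT (F t),
      forall t, 0 <= t -> F t `<=` measurable &
      forall s t, 0 <= s -> s <= t -> F s `<=` F t].

Definition usual_conditions (P : probability Omega R)
    (F : R -> set (set Omega)) : Prop :=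
  [/\ is_filtration F,
      forall t, 0 <= t -> F t = \bigcap_(s in [set s | t < s]) F s &
      forall N, measurable N -> P N = 0%E -> F 0 N].

Definition defaultD0 (tau : Omega -> R) (t : R) : set (set Omega) :=
  preimage_set_system setT (fun w => Num.min (tau w) t) measurable.

Definition defaultD (tau : Omega -> R) (t : R) : set (set Omega) :=
  \bigcap_(s in [set s | t < s]) defaultD0 tau s.

Definition enlargedG (F : R -> set (set Omega)) (tau : Omega -> R) (t : R)
  : set (set Omega) := <<s F t `|` defaultD tau t >>.

End filtrations.

Section density.
Context d (Omega : measurableType d) (R : realType).

Definition jointly_measurable (G : set (set Omega)) (f : Omega -> R -> R)
  : Prop :=
  measurable_fun
    ([set: g_sigma_algebraType G] `*` (`[0, +oo[%classic : set R))
    (fun z : g_sigma_algebraType G * R => f z.1 z.2).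

Definition non_atomic (eta : {measure set R -> \bar R}) : Prop :=
  forall A : set R, measurable A -> (0 < eta A)%E ->
    exists B, [/\ measurable B, B `<=` A, (0 < eta B)%E & (eta B < eta A)%E].

(* A measure on R^+ is a measure on R that does not charge ]-oo, 0[. The
   integral is the extended-real-valued one, so that the equality with a real
   number forces alpha t w to be integrable on B. *)
Definition density_hypothesis (P : probability Omega R)
    (F : R -> set (set Omega)) (tau : Omega -> R)
    (eta : {measure set R -> \bar R}) (alpha : R -> Omega -> R -> R) : Prop :=
  [/\ eta (`]-oo, 0[%classic : set R) = 0%E,
      non_atomic eta &
      forall t, 0 <= t ->
        jointly_measurable (F t) (alpha t) /\
        forall B : set R, measurable B -> B `<=` `[0, +oo[%classic ->
          {ae P, forall w, (condprob P (F t) (tau @^-1` B) w)%:E =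
                           \int[eta]_(u in B) (alpha t w u)%:E}%E].

Definition survival (P : probability Omega R) (F : R -> set (set Omega))
    (tau : Omega -> R) (t : R) : Omega -> R :=
  condprob P (F t) [set w | t < tau w].

Definition is_before_default (P : probability Omega R)
    (F : R -> set (set Omega)) (tau : Omega -> R)
    (eta : {measure set R -> \bar R}) (alpha : R -> Omega -> R -> R)
    (T t : R) (Y : Omega -> R -> R) (Ybd : Omega -> R) : Prop :=
  {ae P, forall w, 0 < survival P F tau t w ->
    Ybd w =
      condexp P (F t)
        (fun w' => Rintegral eta `]t, +oo[%classic
                     (fun u => Y w' u * alpha T w' u)) w
      / survival P F tau t w}.

(* alpha_T(theta) is P-integrable only for eta-almost every theta, hence the
   quantification over theta. Joint measurability is with respect to
   F_t (x) B(R^+), which is what makes Yad at theta = tau well defined a.s. *)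
Definition is_after_default (P : probability Omega R)
    (F : R -> set (set Omega))
    (eta : {measure set R -> \bar R}) (alpha : R -> Omega -> R -> R)
    (T t : R) (Y : Omega -> R -> R) (Yad : Omega -> R -> R) : Prop :=
  jointly_measurable (F t) Yad /\
  {ae eta, forall theta,
    {ae P, forall w,
      Yad w theta =
        condexp P (F t) (fun w' => Y w' theta * alpha T w' theta) w
        / alpha t w theta * \1_[set w' | 0 < alpha t w' theta] w}}.

End density.

(* Main.v *)
Require Import Defs.
From HB Require Import structures.
From mathcomp Require Import all_boot all_order all_algebra.
From mathcomp Require Import all_classical all_reals all_analysis.
From mathcomp Require Import measurable_realfun ring.

Set Implicit Arguments.
Unset Strict Implicit.
Unset Printing Implicit Defensive.

Import Order.TTheory GRing.Theory Num.Theory.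
Import numFieldNormedType.Exports.

Local Open Scope classical_set_scope.
Local Open Scope ring_scope.

(** Write P for the probability, tau for the default time, F for the reference
    filtration and G for the enlarged one.

    The density hypothesis says more than it displays.  For each s >= 0 the
    restriction of the law of (w, tau(w)) to F_s (x) B(R^+) equals
    alpha_s . (P (x) eta), and hence alpha_s >= 0 almost everywhere.  The
    hypothesis gives this on rectangles.  A priori alpha_s is signed and only
    w-by-w integrable, so its positive and negative parts are compared as two
    measures, on a cover on which the first one is finite
    ([density_ae_ge0], [law_density]).  Consequently the expectation of
    g(., tau) is the integral of g alpha_s against P (x) eta for every
    F_s (x) B(R^+)-measurable g ([integral_law_density], [integrable_at_tau],
    [integral_at_tau]), and Fubini's theorem applies in both orders.

    An event of G_t coincides on {tau <= t} with {(., tau) in D} for some D in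
    F_t (x) B(R), and on {t < tau} with some A in F_t: before default, G_t
    carries no information about tau besides survival ([enlargedG_trace]).
    So it suffices to test the candidate for E[Y_T(tau) | G_t] against these
    two kinds of events.

    On {tau <= t} the joint law at time t turns the expectation of
    1_D(., tau) Yad(., tau) into the integral over u, against eta, of the
    expectations E[1_D(., u) 1_{alpha_t(u) > 0} E[Y_T(u) alpha_T(u) | F_t]].
    For fixed u the event in the indicators belongs to F_t, so the inner
    conditional expectation may be removed; the joint law at time T then gives
    the expectation of 1_D(., tau) 1_{alpha_t(tau) > 0} Y_T(tau), and
    alpha_t(tau) > 0 almost surely ([integral_after]).  On {t < tau} the same
    is done with the integral in u inside: it yields S_t, which cancels the
    denominator of Ybd, and {t < tau} is contained in {S_t > 0} up to a null
    set ([integral_before]).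

    That some Yad exists means that the family E[Y_T(u) alpha_T(u) | F_t],
    indexed by u, has a version measurable in (w, u) jointly.  For
    indicators of sets this is a Dynkin class argument, and the layer-cake
    formula carries it over to functions ([joint_condexp]). *)

(** * Integrals, products and null sets *)

Lemma integral_indicM d (T : measurableType d) (R : realType)
    (mu : {measure set T -> \bar R}) (A : set T) (f : T -> R) :
  (\int[mu]_x (\1_A x * f x)%:E = \int[mu]_(x in A) (f x)%:E)%E.
Proof.
rewrite [RHS]integral_mkcond; apply: eq_integral => x _.
by rewrite patchE indicE; case: ifP; rewrite ?mul1r ?mul0r.
Qed.

Lemma integrable_indicM d (T : measurableType d) (R : realType)
    (mu : {measure set T -> \bar R}) (A : set T) (f : T -> R) :
  measurable A -> mu.-integrable setT (EFin \o f) ->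
  mu.-integrable setT (fun x => (\1_A x * f x)%:E).
Proof.
move=> mA intf; have /measurable_EFinP mf := measurable_int mu intf.
apply: le_integrable intf => //.
- by apply/measurable_EFinP; exact: measurable_funM.
- move=> x _; rewrite !abse_EFin lee_fin normrM indicE.
  by case: (_ \in _); rewrite ?normr1 ?mul1r// normr0 mul0r.
Qed.

Lemma ae_eq_integrable d (T : measurableType d) (R : realType)
    (mu : {measure set T -> \bar R}) (f g : T -> \bar R) :
  measurable_fun setT g -> {ae mu, forall x, f x = g x} ->
  mu.-integrable setT f -> mu.-integrable setT g.
Proof.
move=> mg fg intf; have mf := measurable_int mu intf.
apply/integrableP; split => //.
case/integrableP: intf => _; apply: le_lt_trans.
rewrite le_eqVlt; apply/orP; left; apply/eqP.
apply: ge0_ae_eq_integral => //; [exact: measurableT_comp..|].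
by apply: filterS fg => x ->.
Qed.

Lemma ge0_integral_setX d1 d2 (T1 : measurableType d1) (T2 : measurableType d2)
    (R : realType) (m1 : {sigma_finite_measure set T1 -> \bar R})
    (m2 : {sigma_finite_measure set T2 -> \bar R}) (f : T1 * T2 -> \bar R)
    (A : set T1) (B : set T2) :
  measurable A -> measurable B ->
  measurable_fun setT f -> (forall z, 0 <= f z)%E ->
  (\int[m1 \x m2]_(z in A `*` B) f z =
   \int[m1]_(x in A) \int[m2]_(y in B) f (x, y))%E.
Proof.
move=> mA mB mf f0.
rewrite integral_mkcond fubini_tonelli1//; last 2 first.
- by apply/(measurable_restrictT _ _).1; [exact: measurableX|exact: measurable_funTS].
- by move=> z; apply: erestrict_ge0 => ? _.
rewrite [RHS]integral_mkcond; apply: eq_integral => x _.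
rewrite /fubini_F patchE; case: ifPn => xA.
  rewrite [RHS]integral_mkcond; apply: eq_integral => y _.
  rewrite !patchE; congr (if _ then _ else _).
  by apply/idP/idP; rewrite !inE => //; [case|split => //; move: xA; rewrite inE].
apply: integral0_eq => y _; rewrite patchE ifF//; apply/negP.
by rewrite inE => -[/= xA' _]; move: xA; rewrite notin_setE.
Qed.

(** Tonelli's theorem with the first variable restricted to A, as needed to test
    a conditional expectation against an event A. *)
Lemma ge0_fubini_tonelli_set d1 d2 (T1 : measurableType d1)
    (T2 : measurableType d2) (R : realType)
    (m1 : {sigma_finite_measure set T1 -> \bar R})
    (m2 : {sigma_finite_measure set T2 -> \bar R}) (f : T1 * T2 -> \bar R)
    (A : set T1) :
  measurable A -> measurable_fun setT f -> (forall z, 0 <= f z)%E ->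
  (\int[m1]_(x in A) \int[m2]_y f (x, y) =
   \int[m2]_y \int[m1]_(x in A) f (x, y))%E.
Proof.
move=> mA mf f0; rewrite -ge0_integral_setX// integral_mkcond.
have mg : measurable_fun setT (f \_ (A `*` setT)).
  by apply/(measurable_restrictT _ _).1; [exact: measurableX|exact: measurable_funTS].
rewrite fubini_tonelli2//; last by move=> z; apply: erestrict_ge0 => ? _.
apply: eq_integral => y _; rewrite [RHS]integral_mkcond /fubini_G.
apply: eq_integral => x _; rewrite !patchE; congr (if _ then _ else _).
by apply/idP/idP; rewrite !inE => //; case.
Qed.

Section product_ae.
Context d1 d2 (T1 : measurableType d1) (T2 : measurableType d2) (R : realType).
Variables (m1 : {sigma_finite_measure set T1 -> \bar R})
          (m2 : {sigma_finite_measure set T2 -> \bar R}).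

Lemma ae_product_section (Q : T1 * T2 -> Prop) :
  {ae (m1 \x m2)%E, forall z, Q z} ->
  {ae m1, forall x, {ae m2, forall y, Q (x, y)}}.
Proof.
move=> [N [mN N0 QN]].
have mx : measurable_fun setT (m2 \o xsection N) by exact: measurable_fun_xsection.
have : (\int[m1]_x `|(m2 \o xsection N) x| = 0)%E.
  by rewrite -[RHS]N0; apply: eq_integral => x _; rewrite gee0_abs.
move=> /(ae_eq_integral_abs _ measurableT mx); apply: filterS => x /(_ I) N0x.
exists (xsection N x); split => //; first exact: measurable_xsection.
by move=> y nQ; rewrite /xsection /= inE; exact: QN.
Qed.

End product_ae.

(** Dividing by a density and restricting to where it is positive is one
    multiplication by [posinv], a measurable function; x / a * 1_{a > 0} is
    x * posinv a. *)
Definition posinv (R : realType) (x : R) : R := if 0 < x then x^-1 else 0.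

Lemma measurable_posinv (R : realType) : measurable_fun setT (@posinv R).
Proof.
rewrite (_ : @posinv R = fun x => if 0 < x then x `^ (- 1) else 0).
  apply: measurable_fun_ifT => //; exact: measurable_fun_ltr.
apply/funext => x; rewrite /posinv; case: ifPn => // x0.
by rewrite powR_inv1// ltW.
Qed.

(** * Conditional expectation given a sub-sigma-algebra *)

Section sub_sigma_algebras.
Context d (Omega : measurableType d).

Definition is_subsigma (G : set (set Omega)) : Prop :=
  sigma_algebra setT G /\ G `<=` measurable.

(** The inclusion of a coarser sigma-algebra is a measurable map out of the
    finer space; composing with it forgets that a function is measurable for
    less information. *)
Lemma measurable_coarser (G : set (set Omega)) : G `<=` measurable ->
  measurable_fun setT (idfun : Omega -> g_sigma_algebraType G).
Proof.
move=> GM _ B mB; rewrite setTI.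
exact: (smallest_sub (sigma_algebra_measurable Omega) GM).
Qed.

Lemma coarser_measurable_fun (G : set (set Omega)) d' (U : measurableType d')
    (f : Omega -> U) : G `<=` measurable ->
  measurable_fun setT (f : g_sigma_algebraType G -> U) ->
  measurable_fun setT f.
Proof.
by move=> /measurable_coarser mid mf; exact: (measurableT_comp mf mid).
Qed.

Lemma coarser_measurable_fun_prod (G : set (set Omega)) d1
    (E : measurableType d1) d' (U : measurableType d')
    (f : Omega * E -> U) : G `<=` measurable ->
  measurable_fun setT (f : g_sigma_algebraType G * E -> U) ->
  measurable_fun setT f.
Proof.
move=> /measurable_coarser mid mf.
have mp : measurable_fun setT
    (fun z : Omega * E => (idfun z.1 : g_sigma_algebraType G, z.2)).
  apply/measurable_fun_pairP; split; last exact: (@measurable_snd _ _ Omega E).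
  exact: (measurableT_comp mid (@measurable_fst _ _ Omega E)).
have H := measurableT_comp mf mp.
by apply: eq_measurable_fun H => -[x y] _.
Qed.

Lemma measurable_g_sigmaP (G : set (set Omega)) (A : set Omega) :
  sigma_algebra setT G ->
  measurable (A : set (g_sigma_algebraType G)) <-> G A.
Proof. by move=> sG; rewrite measurable_g_measurableTypeE. Qed.

End sub_sigma_algebras.

Section conditional_expectation.
Context d (Omega : measurableType d) (R : realType).
Variables (P : probability Omega R) (G : set (set Omega)).
Hypothesis sG : is_subsigma G.

Let GM : G `<=` measurable. Proof. by case: sG. Qed.

Let id_mfun : {mfun Omega >-> g_sigma_algebraType G} :=
  mfun_Sub (mem_set (measurable_coarser GM)).

Let mGP A : measurable (A : set (g_sigma_algebraType G)) <-> G A.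
Proof. by apply: measurable_g_sigmaP; case: sG. Qed.

(** The integral of X over the events of G is a charge dominated by the
    restriction of P to G, and Z is its Radon-Nikodym derivative. *)
Lemma is_condexp_exists (X : Omega -> R) :
  P.-integrable setT (EFin \o X) -> exists Z, is_condexp P G X Z.
Proof.
move=> iX.
pose PG := distribution P id_mfun.
pose nu : set (g_sigma_algebraType G) -> \bar R :=
  fun A => (\int[P]_(w in A) (EFin \o X) w)%E.
have nu0 : nu set0 = 0%E by rewrite /nu integral_set0.
have nufin A : measurable A -> nu A \is a fin_num.
  move=> mA; apply: (@fin_num_measure _ _ _ (induced_charge iX) A).
  by apply: GM; apply/mGP.
have nuadd : semi_sigma_additive nu.
  move=> F mF tF mUF.
  apply: (@charge_semi_sigma_additive _ _ _ (induced_charge iX) F) => //.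
    by move=> n; apply: GM; apply/mGP; exact: mF.
  by apply: GM; apply/mGP.
pose nuC : {charge set (g_sigma_algebraType G) -> \bar R} :=
  HB.pack nu (isCharge.Build _ _ _ nu nu0 nufin nuadd).
have dom : nuC `<< PG.
  apply/null_content_dominatesP => A mA PA.
  have mA' : measurable (A : set Omega) by apply: GM; apply/mGP.
  apply: null_set_integral => //.
  have mX := measurable_int P iX.
  exact: (@measurable_funS _ _ Omega _ setT).
have RNint := Radon_Nikodym_integrable dom.
pose Z := fine \o (Radon_Nikodym nuC PG).
have ZE : EFin \o Z = Radon_Nikodym nuC PG.
  by apply/funext => w; rewrite /Z /= fineK// Radon_Nikodym_fin_num.
have mZ : measurable_fun setT (EFin \o Z : g_sigma_algebraType G -> \bar R).
  by rewrite ZE; exact: measurable_int RNint.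
have iZ : P.-integrable setT (EFin \o Z).
  apply/integrableP; split.
    exact: (coarser_measurable_fun GM mZ).
  case/integrableP: RNint => _; apply: le_lt_trans.
  rewrite -ZE [leRHS](ge0_integral_pushforward (measurable_coarser GM))//.
  exact: measurableT_comp mZ.
exists Z; split => //.
  exact/measurable_EFinP.
move=> A GA.
have mA : measurable (A : set (g_sigma_algebraType G)) by apply/mGP.
have := Radon_Nikodym_integral dom mA; rewrite -ZE => H.
transitivity (nuC A) => //; rewrite {}H.
rewrite [RHS](integral_pushforward (measurable_coarser GM))//.
by apply: integrableS iZ => //; exact: GM.
Qed.

Lemma is_condexp_condexp (X : Omega -> R) :
  P.-integrable setT (EFin \o X) -> is_condexp P G X (condexp P G X).
Proof.
move=> /is_condexp_exists[Z XZ].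
exact: (@xgetI _ (cst 0) [set Z | is_condexp P G X Z] Z XZ).
Qed.

(** The event {Z' < Z} belongs to G, and the integral over it of Z - Z' equals
    that of X - X', which is nonpositive. *)
Lemma is_condexp_ae_le (X X' Z Z' : Omega -> R) :
  is_condexp P G X Z -> is_condexp P G X' Z' -> (forall w, X w <= X' w) ->
  {ae P, forall w, Z w <= Z' w}.
Proof.
move=> [iX mZ iZ XZ] [iX' mZ' iZ' XZ'] XX'.
pose A := [set w | Z' w < Z w].
have GA : G A.
  apply/mGP.
  have /= := measurable_fun_ltr mZ' mZ measurableT (Y := [set true]).
  by rewrite setTI; apply.
have mA : measurable A by exact: GM.
have iS f : P.-integrable setT (EFin \o f) -> P.-integrable A (EFin \o f).
  by apply: integrableS.
have H : (\int[P]_(w in A) `|(Z w)%:E - (Z' w)%:E| = 0)%E.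
  apply/eqP; rewrite eq_le integral_ge0// andbT.
  rewrite (eq_integral (fun w => (Z w)%:E - (Z' w)%:E)%E); last first.
    move=> w; rewrite inE => Aw.
    by rewrite -EFinB /= ger0_norm// subr_ge0 ltW.
  rewrite integralB_EFin//; [|exact: iS..].
  rewrite XZ// XZ'// sube_le0.
  by apply: le_integral; [exact: mA|exact: iS|exact: iS|move=> w _; rewrite lee_fin].
have mZZ : measurable_fun A (fun w => (Z w)%:E - (Z' w)%:E)%E.
  by apply: emeasurable_funB; apply: measurable_funTS;
    [exact: measurable_int iZ|exact: measurable_int iZ'].
have /(ae_eq_integral_abs P mA mZZ) := H.
apply: filterS => w h; rewrite leNgt; apply/negP => Aw.
have := h Aw; rewrite /= -EFinB => -[] /eqP.
by rewrite subr_eq0 => /eqP ZZ'; move: Aw; rewrite ZZ' ltxx.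
Qed.

Lemma is_condexp_ae_eq (X Z Z' : Omega -> R) :
  is_condexp P G X Z -> is_condexp P G X Z' -> {ae P, forall w, Z w = Z' w}.
Proof.
move=> XZ XZ'.
have h1 := is_condexp_ae_le XZ XZ' (fun w => lexx (X w)).
have h2 := is_condexp_ae_le XZ' XZ (fun w => lexx (X w)).
by apply: filterS2 h1 h2 => w z1 z2; apply/eqP; rewrite eq_le z1.
Qed.

(** The sign of Z is G-measurable: on {Z >= 0} and on its complement, the
    integral of |Z| is plus or minus the integral of X. *)
Lemma is_condexp_contraction (X Z : Omega -> R) : is_condexp P G X Z ->
  (\int[P]_w `|(Z w)%:E| <= \int[P]_w `|(X w)%:E|)%E.
Proof.
move=> [iX mZ iZ XZ].
pose A := [set w | 0 <= Z w].
have GA : G A.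
  apply/mGP.
  have := mZ measurableT _ (measurable_itv `[0, +oo[).
  by rewrite setTI preimage_itvcy.
have GAC : G (~` A) by apply/mGP; apply: measurableC; apply/mGP.
have [mA mAC] : measurable A /\ measurable (~` A) by split; exact: GM.
have mabs f B : measurable B -> P.-integrable setT (EFin \o f) ->
    measurable_fun B (fun w => `|(f w)%:E|)%E.
  move=> mB i; apply: measurable_funTS; apply: measurableT_comp => //.
  exact: measurable_int i.
rewrite -(setvU A) !ge0_integral_setU//; last 4 first.
- by rewrite setvU; exact: mabs.
- by apply/disj_setPS => w [].
- by rewrite setvU; exact: mabs.
- by apply/disj_setPS => w [].
apply: leeD.
- rewrite (eq_integral (fun w => - (Z w)%:E)%E); last first.
    move=> w; rewrite inE /A /= => /negP; rewrite -ltNge => Zw.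
    by rewrite ltr0_norm.
  rewrite (_ : \int[P]_(w in _) _ = - \int[P]_(w in ~` A) (Z w)%:E)%E; last first.
    rewrite integralN//; apply: integrable_add_def => //.
    exact: (integrableS measurableT mAC (@subsetT _ _) iZ).
  rewrite XZ//.
  apply: le_trans (le_abse_integral P mAC _); last first.
    by apply: measurable_funTS; exact: measurable_int iX.
  by rewrite -abseN; exact: lee_abs.
- rewrite (eq_integral (fun w => (Z w)%:E)); last first.
    by move=> w; rewrite inE /A /= => Zw; rewrite ger0_norm.
  rewrite XZ//.
  apply: le_trans (le_abse_integral P mA _); first exact: lee_abs.
  by apply: measurable_funTS; exact: measurable_int iX.
Qed.

Lemma is_condexpB (X X' Z Z' : Omega -> R) :
  is_condexp P G X Z -> is_condexp P G X' Z' ->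
  is_condexp P G (X \- X') (Z \- Z').
Proof.
move=> [iX mZ iZ XZ] [iX' mZ' iZ' XZ'].
split; [exact: (integrableB measurableT iX iX')|exact: measurable_funB|
  exact: (integrableB measurableT iZ iZ')|].
move=> A GA; have mA := GM GA.
have iS f : P.-integrable setT (EFin \o f) -> P.-integrable A (EFin \o f).
  by apply: integrableS.
transitivity (\int[P]_(w in A) ((Z w)%:E - (Z' w)%:E))%E; first by [].
rewrite integralB_EFin//; [|exact: iS..].
rewrite XZ// XZ'// -integralB_EFin//; exact: iS.
Qed.

Lemma is_condexp_cst (c : R) : is_condexp P G (cst c) (cst c).
Proof. split=> //; exact: finite_measure_integrable_cst. Qed.

(** Lets a conditional expectation be built as a nonnegative extended-valued
    function, for which sums and integrals in a parameter always make sense. *)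
Lemma is_condexp_fine (X : Omega -> R) (h : g_sigma_algebraType G -> \bar R) :
  P.-integrable setT (EFin \o X) ->
  measurable_fun setT h -> (forall w, 0 <= h w)%E ->
  (forall A, G A ->
    \int[P]_(w in A) h w = \int[P]_(w in A) (X w)%:E)%E ->
  is_condexp P G X (fine \o h) /\
  {ae P, forall w : Omega, h w = (fine (h w))%:E}.
Proof.
move=> iX mh h0 hX.
have GT : G setT by apply/mGP.
have mh' : measurable_fun setT (h : Omega -> \bar R).
  exact: coarser_measurable_fun mh.
have ih : P.-integrable setT (h : Omega -> \bar R).
  apply/integrableP; split=> //.
  under eq_integral do rewrite gee0_abs//.
  by rewrite hX//; exact: integrable_lty.
have hfin : {ae P, forall w : Omega, h w = (fine (h w))%:E}.
  apply: filterS (integrable_ae measurableT ih) => w /(_ I) hw.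
  by rewrite fineK.
have mfh : measurable_fun setT (fine \o h).
  by apply: (measurableT_comp _ mh).
have mfh' : measurable_fun setT (EFin \o (fine \o h) : Omega -> \bar R).
  by apply/measurable_EFinP; exact: coarser_measurable_fun mfh.
split=> //; split=> //.
  apply/integrableP; split=> //.
  case/integrableP: ih => _; apply: le_lt_trans.
  rewrite le_eqVlt; apply/orP; left; apply/eqP.
  apply: ge0_ae_eq_integral => //; [exact: measurableT_comp..|].
  by apply: filterS hfin => w + _ => ->.
move=> A GA; rewrite -hX//; have mA := GM GA.
apply: ae_eq_integral => //; [exact: measurable_funTS..|].
by apply: filterS hfin => w + _ => /= <-.
Qed.

End conditional_expectation.

(** * Events of the enlarged filtration *)

Section enlarged_filtration.
Context d (Omega : measurableType d) (R : realType).
Variables (F : R -> set (set Omega)) (tau : Omega -> R) (t : R).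

Lemma is_subsigma_filtration s : is_filtration F -> 0 <= s -> is_subsigma (F s).
Proof. by move=> [sF FM _] s0; split; [exact: sF|exact: FM]. Qed.

(** One time s > t already gives measurability; s = t + 1 is as good as any. *)
Lemma defaultD_measurable : measurable_fun setT tau ->
  defaultD tau t `<=` measurable.
Proof.
move=> mtau A /(_ (t + 1)); rewrite /= ltrDl ltr01 => /(_ isT)[B mB <-].
have mmin : measurable_fun setT (fun w => Num.min (tau w) (t + 1)).
  by apply: measurable_minr => //; exact: measurable_cst.
exact: mmin.
Qed.

Lemma is_subsigma_enlargedG : is_filtration F -> 0 <= t ->
  measurable_fun setT tau -> is_subsigma (enlargedG F tau t).
Proof.
move=> [_ FM _] t0 mtau; split; first exact: smallest_sigma_algebra.
apply: smallest_sub; first exact: sigma_algebra_measurable.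
by move=> A [/(FM _ t0)|/(defaultD_measurable mtau)].
Qed.

Lemma sub_enlargedG : F t `<=` enlargedG F tau t.
Proof. by move=> A FA; apply: sub_sigma_algebra; left. Qed.

Lemma default_event_enlargedG : enlargedG F tau t [set w | tau w <= t].
Proof.
apply: sub_sigma_algebra; right => s /= ts.
exists `]-oo, t]%classic; first exact: measurable_itv.
rewrite setTI; apply/seteqP; split => w /=; rewrite in_itv/= ge_min.
  by move=> /orP[//|st]; move: (lt_le_trans ts st); rewrite ltxx.
by move=> ->.
Qed.

(** For every s > t, min(tau, t) is a function of min(tau, s), hence it passes
    to the right limit. *)
Lemma measurable_stopped_enlargedG :
  measurable_fun setT ((fun w => Num.min (tau w) t) :
    g_sigma_algebraType (enlargedG F tau t) -> R).
Proof.
move=> _ B mB; rewrite setTI.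
apply: sub_sigma_algebra; apply: sub_sigma_algebra; right => s /= ts.
have mmin : measurable_fun setT (fun x : R => Num.min x t).
  by apply: measurable_minr => //; exact: measurable_cst.
exists ((fun x : R => Num.min x t) @^-1` B).
  by rewrite -[X in measurable X]setTI; exact: mmin.
rewrite setTI; apply/seteqP; split => w /=; rewrite -minA (min_idPr (ltW ts))//.
Qed.

Definition trace_representation (C : set Omega) :=
  exists (D : set (Omega * R)) (A : set Omega),
  [/\ measurable (D : set (g_sigma_algebraType (F t) * R)), F t A &
      forall w, (tau w <= t -> (C w <-> D (w, tau w))) /\
                (t < tau w -> (C w <-> A w))].

(** The events that have such a representation form a sigma-algebra.  It
    contains those of D_t because each of them belongs to sigma(min(tau, s)) for
    all s > t: with s = t + 1 one reads the set of values of tau below t, and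
    two outcomes w0, w with later default cannot be separated, since
    s = min(tau w0, tau w) > t identifies min(tau, s) at both. *)
Lemma enlargedG_trace (C : set Omega) : is_filtration F -> 0 <= t ->
  enlargedG F tau t C -> trace_representation C.
Proof.
move=> filF t0.
have [sFt _] := is_subsigma_filtration filF t0.
have [F0 FC FU] := sFt.
have mF A : measurable (A : set (g_sigma_algebraType (F t))) <-> F t A.
  exact: measurable_g_sigmaP.
have FT : F t setT by have := FC _ F0; rewrite setD0.
apply: smallest_sub.
  split.
  - exists set0, set0; split => //.
  - move=> B [D [A [mD FA DA]]]; exists (~` D), (~` A); split.
    + exact: measurableC.
    + by rewrite -setTD; exact: FC.
    + move=> w; have [wD wA] := DA w; rewrite setTD; split.
        by move=> /wD BD; split => nB; apply: contra_not nB; apply BD.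
      by move=> /wA BA; split => nB; apply: contra_not nB; apply BA.
  - move=> B /choice[D /choice[A DA]].
    exists (\bigcup_n D n), (\bigcup_n A n); split.
    + by apply: bigcupT_measurable => n; have [] := DA n.
    + by apply: FU => n; have [] := DA n.
    + move=> w; split => wt; split.
      * move=> [n _ Bn]; exists n => //; have [_ _ /(_ w)[+ _]] := DA n.
        by move=> /(_ wt) [+ _]; exact.
      * move=> [n _ Bn]; exists n => //; have [_ _ /(_ w)[+ _]] := DA n.
        by move=> /(_ wt) [_ +]; exact.
      * move=> [n _ Bn]; exists n => //; have [_ _ /(_ w)[_ +]] := DA n.
        by move=> /(_ wt) [+ _]; exact.
      * move=> [n _ Bn]; exists n => //; have [_ _ /(_ w)[_ +]] := DA n.
        by move=> /(_ wt) [_ +]; exact.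
move=> B [FB|DB].
  exists (B `*` setT), B; split => //.
    by apply: measurableX => //; apply/mF.
  by move=> w; split => _; split => // -[].
have tt1 : t < t + 1 by rewrite ltrDl.
have [B1 mB1 B1E] := DB _ tt1.
exists (setT `*` B1), (if `[< exists2 w, B w & t < tau w >] then setT else set0).
split.
- exact: measurableX.
- by case: ifP.
move=> w; split => wt.
  rewrite -B1E setTI /= (min_idPl _); last by rewrite (le_trans wt)// lerDl.
  by split => [|[]].
case: asboolP => [[w0 Bw0 tw0]|nB]; last first.
  by split => // Bw; apply: nB; exists w.
split => // _.
have ts : t < Num.min (tau w0) (tau w) by rewrite lt_min tw0.
have [B2 mB2 B2E] := DB _ ts.
move: Bw0; rewrite -B2E !setTI /=.
rewrite (min_idPr _) ?ge_min ?lexx//.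
by rewrite (min_idPr (_ : _ <= tau w)) ?ge_min ?lexx ?orbT.
Qed.

End enlarged_filtration.

(** * The layer-cake formula and image densities *)

Section layer_cake.
Context {R : realType}.
Local Notation leb := (@lebesgue_measure R).

Definition undergraph T (g : T -> \bar R) : set (T * R) :=
  [set z | 0 <= z.2 /\ (z.2%:E < g z.1)%E].

Lemma measurable_undergraph d (T : measurableType d) (g : T -> \bar R) :
  measurable_fun setT g -> measurable (undergraph g).
Proof.
move=> mg.
have m1 : measurable ([set: T] `*` `[0%R, +oo[%classic : set (T * R)).
  exact: measurableX.
have m2 : measurable (setT `&` [set z : T * R | (z.2%:E < g z.1)%E]).
  apply: measurable_lte => //.
  - by apply: measurableT_comp => //; exact: measurable_snd.
  - exact: (measurableT_comp mg measurable_fst).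
rewrite (_ : undergraph g = ([set: T] `*` `[0%R, +oo[%classic) `&`
  (setT `&` [set z : T * R | (z.2%:E < g z.1)%E])); first exact: measurableI.
apply/seteqP; split => -[x r]; rewrite /undergraph /= in_itv/= andbT.
  by move=> [].
by move=> [[_ ?] [_ ?]].
Qed.

(** The section of the undergraph at x is the interval [0, g x[. *)
Lemma layer_cake T (g : T -> \bar R) (x : T) : (0 <= g x)%E ->
  (\int[leb]_r (\1_(undergraph g) (x, r))%:E = g x)%E.
Proof.
move=> gx0.
have -> : (fun r => (\1_(undergraph g) (x, r))%:E : \bar R) =
          (fun r => (\1_(xsection (undergraph g) x) r)%:E).
  by apply/funext => r; rewrite !indicE mem_xsection.
have xsE : xsection (undergraph g) x = [set r | 0 <= r /\ (r%:E < g x)%E].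
  by apply/seteqP; split => r; rewrite /xsection/= inE.
rewrite xsE; move: (g x) gx0 => [y y0| _ |//].
- rewrite (_ : [set r | _] = `[0, y[%classic); last first.
    apply/seteqP; split => r /=; rewrite in_itv/= lte_fin.
      by move=> [-> ->].
    by move=> /andP[].
  rewrite integral_indic// setIT/= lebesgue_measure_itv/= lte_fin.
  by case: ltP => [_|y0']; rewrite ?sube0//; congr (_%:E); apply/le_anti/andP.
- rewrite (_ : [set r | _] = `[0, +oo[%classic); last first.
    apply/seteqP; split => r /=; rewrite in_itv/= andbT; first by case.
    by move=> ->; rewrite ltry.
  by rewrite integral_indic// setIT/= lebesgue_measure_itv/= ltry.
Qed.

(** An identity between a measure and a density, known for sets, extends to
    nonnegative functions without approximation: apply it to the level sets
    {r < g} and integrate over r, exchanging integrals by Tonelli's theorem. *)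
Lemma integral_image_density d1 d2 d3 (X1 : measurableType d1)
    (X2 : measurableType d2) (Y : measurableType d3)
    (mu1 : {sigma_finite_measure set X1 -> \bar R})
    (mu2 : {sigma_finite_measure set X2 -> \bar R})
    (phi : X1 -> Y) (psi : X2 -> Y) (f : X2 -> \bar R) (g : Y -> \bar R) :
  measurable_fun setT phi -> measurable_fun setT psi ->
  measurable_fun setT f -> (forall x, 0 <= f x)%E ->
  (forall D, measurable D ->
    mu1 (phi @^-1` D) = \int[mu2]_(x in psi @^-1` D) f x)%E ->
  measurable_fun setT g -> (forall y, 0 <= g y)%E ->
  (\int[mu1]_x g (phi x) = \int[mu2]_x (f x * g (psi x)))%E.
Proof.
move=> mphi mpsi mf f0 H mg g0.
have mU := measurable_undergraph mg.
have mI d (X : measurableType d) (k : X -> Y) : measurable_fun setT k ->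
    measurable_fun setT (fun z : X * R => (\1_(undergraph g) (k z.1, z.2))%:E : \bar R).
  move=> mk; apply/measurable_EFinP.
  have mk' : measurable_fun setT (fun z : X * R => (k z.1, z.2)).
    apply/measurable_fun_pairP; split; last exact: measurable_snd.
    exact: (measurableT_comp mk measurable_fst).
  exact: (measurableT_comp (@measurable_indic _ _ R setT _ mU) mk').
under eq_integral do rewrite -layer_cake//.
rewrite (@fubini_tonelli _ _ _ _ R mu1 leb _ (mI _ _ _ mphi)); last first.
  by move=> z; rewrite lee_fin.
have mUr r : measurable (ysection (undergraph g) r) by exact: measurable_ysection.
under eq_integral => r _.
  rewrite (_ : \int[mu1]_x _ =
    \int[mu2]_x (f x * (\1_(undergraph g) (psi x, r))%:E))%E; last first.
    rewrite (_ : (fun x => (\1_(undergraph g) (phi x, r))%:E) =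
      (fun x => (\1_(phi @^-1` ysection (undergraph g) r) x)%:E)); last first.
      by apply/funext => x; rewrite !indicE -mem_ysection.
    have mphi' : measurable (phi @^-1` ysection (undergraph g) r).
      by rewrite -[X in measurable X]setTI; exact: mphi.
    rewrite integral_indic// setIT [LHS](H _ (mUr r)).
    rewrite integral_mkcond epatch_indic.
    by apply: eq_integral => x _; rewrite /= !indicE -mem_ysection.
  over.
have mfI : measurable_fun setT
    (fun z : X2 * R => f z.1 * (\1_(undergraph g) (psi z.1, z.2))%:E)%E.
  apply: emeasurable_funM; last exact: mI.
  exact: (measurableT_comp mf measurable_fst).
rewrite -(@fubini_tonelli _ _ _ _ R mu2 leb _ mfI); last first.
  by move=> z; rewrite mule_ge0// lee_fin.
apply: eq_integral => x _ /=.
rewrite ge0_integralZl//.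
- by rewrite layer_cake.
- exact: (measurableT_comp (mI _ _ _ mpsi) (pair1_measurable x)).
Qed.

End layer_cake.

Section sigma_finite_product.
Context d1 d2 (T1 : measurableType d1) (T2 : measurableType d2) (R : realType).
Variables (m1 : {sigma_finite_measure set T1 -> \bar R})
          (m2 : {sigma_finite_measure set T2 -> \bar R}).

(** The product measure under a name to which the structure of sigma-finite
    measure is attached. *)
Definition product_sfm : set (T1 * T2) -> \bar R := (m1 \x m2)%E.

HB.instance Definition _ := Measure.on product_sfm.

Let product_sfm_sigma_finite : sigma_finite setT product_sfm.
Proof.
have /sigma_finiteP[F [TF ndF Foo]] := sigma_finiteT m1.
have /sigma_finiteP[H [TH ndH Hoo]] := sigma_finiteT m2.
exists (fun n => F n `*` H n).
  rewrite -setXTT TF TH; apply/seteqP; split=> -[x y].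
    move=> [/= [n _ Fnx] [k _ Hky]]; exists (maxn n k) => //; split.
    - by move: x Fnx; exact/subsetPset/ndF/leq_maxl.
    - by move: y Hky; exact/subsetPset/ndH/leq_maxr.
  by move=> [n _ []/= ? ?]; split; exists n.
move=> k; have [? ?] := Foo k; have [? ?] := Hoo k.
split; first exact: measurableX.
by rewrite /product_sfm product_measure1E// lte_mul_pinfty// ge0_fin_numE.
Qed.

HB.instance Definition _ := Measure_isSigmaFinite.Build _ _ _ product_sfm
  product_sfm_sigma_finite.

End sigma_finite_product.

Section image_density.
Context d1 d2 (X : measurableType d1) (Y : measurableType d2) (R : realType).
Variables (mu : {measure set X -> \bar R}) (psi : X -> Y) (f : X -> \bar R).
Hypotheses (mpsi : measurable_fun setT psi) (mf : measurable_fun setT f).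
Hypothesis f0 : forall x, (0 <= f x)%E.

(** The image by psi of the measure f . mu.  The hypotheses are arguments, so
    that the measure structure can be inferred from the term. *)
Definition image_density_of of measurable_fun setT psi & measurable_fun setT f
    & (forall x, 0 <= f x)%E :=
  fun D : set Y => (\int[mu]_(x in psi @^-1` D) f x)%E.

Local Notation image_density := (image_density_of mpsi mf f0).

Let image_density0 : image_density set0 = 0%E.
Proof. by rewrite /image_density_of preimage_set0 integral_set0. Qed.

Let image_density_ge0 D : (0 <= image_density D)%E.
Proof. exact: integral_ge0. Qed.

Let image_density_sigma_additive : semi_sigma_additive image_density.
Proof.
move=> F mF tF mUF; rewrite /image_density_of preimage_bigcup.
have mpF n : measurable (psi @^-1` F n).
  by rewrite -[X in measurable X]setTI; exact: mpsi.
apply: semi_sigma_additive_nng_induced => //.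
  apply/trivIsetP => /= i j _ _ ij; rewrite -preimage_setI.
  by move/trivIsetP : tF => /(_ _ _ _ _ ij) ->//; rewrite preimage_set0.
exact: bigcupT_measurable.
Qed.

HB.instance Definition _ := isMeasure.Build _ _ _ image_density
  image_density0 image_density_ge0 image_density_sigma_additive.

End image_density.

(** * The joint law of the default time and the reference information *)

Section joint_law.
Context d (Omega : measurableType d) (R : realType).
Variables (P : probability Omega R) (G : set (set Omega)).
Hypothesis sG : is_subsigma G.
Variables (tau : Omega -> R) (eta : {sigma_finite_measure set R -> \bar R}).
Hypothesis mtau : measurable_fun setT tau.
Variable f : Omega * R -> R.
Hypothesis mf : measurable_fun setT (f : g_sigma_algebraType G * R -> R).
Hypothesis condlaw : forall B : set R, measurable B ->
  {ae P, forall w, (condprob P G (tau @^-1` B) w)%:E =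
                   (\int[eta]_(u in B) (f (w, u))%:E)%E}.

Local Notation OmG := (g_sigma_algebraType G).
Local Notation fp := ((EFin \o f)^\+)%E.
Local Notation fn := ((EFin \o f)^\-)%E.

Let GM : G `<=` measurable. Proof. by case: sG. Qed.

Let mGP A : measurable (A : set OmG) <-> G A.
Proof. by apply: measurable_g_sigmaP; case: sG. Qed.

Let mfp : measurable_fun setT (fp : OmG * R -> \bar R).
Proof. by apply: measurable_funepos; exact/measurable_EFinP. Qed.

Let mfn : measurable_fun setT (fn : OmG * R -> \bar R).
Proof. by apply: measurable_funeneg; exact/measurable_EFinP. Qed.

Let mfp' : measurable_fun setT (fp : Omega * R -> \bar R).
Proof. exact: coarser_measurable_fun_prod mfp. Qed.

Let mfn' : measurable_fun setT (fn : Omega * R -> \bar R).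
Proof. exact: coarser_measurable_fun_prod mfn. Qed.

Let phi (w : Omega) : OmG * R := (w, tau w).
Let psi (z : Omega * R) : OmG * R := z.

Let mphi : measurable_fun setT phi.
Proof. by apply/measurable_fun_pairP; split => //; exact: measurable_coarser. Qed.

Let mpsi : measurable_fun setT psi.
Proof.
apply/measurable_fun_pairP; split; last exact: measurable_snd.
exact: (measurableT_comp (measurable_coarser GM) measurable_fst).
Qed.

Let cst1_ge0 (w : Omega) : (0 <= cst 1 w :> \bar R)%E. Proof. by []. Qed.

(* The law of (id, tau) on G (x) B(R), and the positive and negative parts of
   f . (P (x) eta) restricted to that sigma-algebra. *)
Let law := image_density_of P mphi (measurable_cst _) cst1_ge0.
Let law_pos := image_density_of (P \x eta)%E mpsi mfp' (funepos_ge0 _).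
Let law_neg := image_density_of (P \x eta)%E mpsi mfn' (funeneg_ge0 _).

Let lawE D : measurable D -> law D = P (phi @^-1` D).
Proof.
move=> mD; have mphiD : measurable (phi @^-1` D).
  by rewrite -[X in measurable X]setTI; exact: mphi.
by rewrite /law /image_density_of integral_cst// mul1e.
Qed.

Let sectionp w (B : set R) : (\int[eta]_(u in B)
  (fun u => (f (w, u))%:E)^\+ u = \int[eta]_(u in B) fp (w, u))%E.
Proof. by apply: eq_integral => u _; rewrite !funeposE. Qed.

Let sectionn w (B : set R) : (\int[eta]_(u in B)
  (fun u => (f (w, u))%:E)^\- u = \int[eta]_(u in B) fn (w, u))%E.
Proof. by apply: eq_integral => u _; rewrite !funenegE. Qed.

(** The identity of measures [law_decomp] on the rectangle A x B.  The negative
    part is moved to the other side because both parts may have an infinite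
    integral over A. *)
Let integral_condlaw (A : set Omega) (B : set R) : G A -> measurable B ->
  (\int[P]_(w in A) \int[eta]_(u in B) fp (w, u) =
   P (A `&` tau @^-1` B) +
   \int[P]_(w in A) \int[eta]_(u in B) fn (w, u))%E.
Proof.
move=> GA mB.
have mA : measurable A by exact: GM.
have mtB : measurable (tau @^-1` B).
  by rewrite -[X in measurable X]setTI; exact: mtau.
pose Z := condprob P G (tau @^-1` B).
have XZ : is_condexp P G \1_(tau @^-1` B) Z.
  by apply: is_condexp_condexp => //; exact: integrable_indic.
have Z0 : {ae P, forall w, 0 <= Z w}.
  exact: (is_condexp_ae_le sG (is_condexp_cst P G 0) XZ).
have [iX mZ iZ intZ] := XZ.
have ms g : measurable_fun setT (g : Omega * R -> \bar R) ->
    (forall z, 0 <= g z)%E ->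
    measurable_fun setT (fun w => \int[eta]_(u in B) g (w, u))%E.
  move=> mg g0.
  rewrite (_ : (fun w => _) =
      fun w => (\int[eta]_u (g \_ ([set: Omega] `*` B)) (w, u))%E).
    apply: measurable_fun_fubini_tonelli_F.
      apply/(measurable_restrictT _ _).1; first exact: measurableX.
      exact: measurable_funTS.
    by move=> z; apply: erestrict_ge0.
  apply/funext => w; rewrite integral_mkcond; apply: eq_integral => u _.
  rewrite !patchE; congr (if _ then _ else _).
  by apply/idP/idP; rewrite !inE => //; case.
have mZp : measurable_fun setT (fun w => (Order.max (Z w) 0)%:E : \bar R).
  apply/measurable_EFinP; apply: measurable_maxr => //.
  by apply/measurable_EFinP; exact: measurable_int iZ.
transitivity (\int[P]_(w in A) ((Order.max (Z w) 0)%:E +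
    \int[eta]_(u in B) fn (w, u)))%E.
  apply: ge0_ae_eq_integral => //.
  - by apply: measurable_funTS; exact: ms.
  - apply: measurable_funTS; apply: emeasurable_funD => //.
    exact: ms.
  - by move=> w _; apply: integral_ge0.
  - move=> w _; apply: adde_ge0; last exact: integral_ge0.
    by rewrite lee_fin le_max lexx orbT.
  apply: filterS2 (condlaw mB) Z0 => w + Zw _; rewrite -/(Z w) integralE.
  rewrite (max_idPl Zw).
  rewrite sectionp sectionn.
  have : (0 <= \int[eta]_(u in B) fn (w, u))%E by exact: integral_ge0.
  (* The difference of the two integrals is a real number, hence both are
     finite. *)
  case: (\int[eta]_(u in B) fn (w, u))%E => [b| |//] _; last first.
    by case: (\int[eta]_(u in B) fp (w, u))%E.
  case: (\int[eta]_(u in B) fp (w, u))%E => [a|//|//].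
  by rewrite -EFinB => -[->]; rewrite -EFinD subrK.
rewrite ge0_integralD//; first last.
- by apply: measurable_funTS; exact: ms.
- by move=> w _; exact: integral_ge0.
- exact: measurable_funTS.
- by move=> w _; rewrite lee_fin le_max lexx orbT.
congr (_ + _)%E.
transitivity (\int[P]_(w in A) (Z w)%:E)%E.
  apply: ae_eq_integral => //; first exact: measurable_funTS.
  - by apply: measurable_funTS; exact: measurable_int iZ.
  - by apply: filterS Z0 => w Zw _ /=; rewrite (max_idPl Zw).
by rewrite intZ// integral_indic// setIC.
Qed.

Let Ip (w : OmG) : \bar R := (\int[eta]_u fp (w, u))%E.

Let mIp : measurable_fun setT Ip.
Proof. by apply: measurable_fun_fubini_tonelli_F. Qed.

Let Ip_fin : {ae P, forall w : Omega, (Ip (w : OmG) < +oo)%E}.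
Proof.
apply: filterS (condlaw measurableT) => w; rewrite integralE sectionp -/(Ip w).
case: (Ip w) => [r _|//|//]; first by rewrite ltry.
by case: (integral _ _ _).
Qed.

(** Both sides are measures that agree on rectangles, and the sets where the
    integral of the positive part is at most k, completed by the null set where
    it is infinite, cover the space. *)
Let law_decomp (D : set (OmG * R)) : measurable D ->
  law_pos D = (law D + law_neg D)%E.
Proof.
move=> mD.
pose rect := [set A `*` B | A in (@measurable _ OmG) & B in (@measurable _ R)].
pose cov k := [set w : OmG | (Ip w <= k%:R%:E)%E \/ Ip w = +oo%E].
have mcov k : measurable (cov k : set OmG).
  have -> : cov k = (setT `&` [set w | (Ip w <= k%:R%:E)%E]) `|`
                    (setT `&` Ip @^-1` [set +oo%E]).
    by rewrite !setTI.
  apply: measurableU; first exact: emeasurable_fun_infty_c.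
  by apply: mIp => //; exact: emeasurable_set1.
transitivity (measure_add law law_neg D); last by rewrite measure_addE.
apply: (measure_unique rect (fun k => cov k `*` setT)) => //.
- exact: measurable_prod_measurableType.
- move=> _ _ [A1 mA1 [B1 mB1 <-]] [A2 mA2 [B2 mB2 <-]]; rewrite -setXI.
  by exists (A1 `&` A2); [exact: measurableI|exists (B1 `&` B2) => //;
    exact: measurableI].
- by move=> k; exists (cov k) => //; exists setT.
- apply/seteqP; split => // -[w u] _.
  have : (0 <= Ip w)%E by exact: integral_ge0.
  case Iw : (Ip w) => [r| |//]; rewrite ?lee_fin => r0.
    exists (Num.bound r) => //; split => //; left; rewrite Iw lee_fin.
    by rewrite (le_trans (ler_norm r))// ltW// (le_lt_trans _ (archi_boundP _))// ger0_norm.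
  by exists 0%N => //; split => //; right.
- move=> _ [A mA [B mB <-]].
  have GA : G A by apply/mGP.
  have mA' : measurable (A : set Omega) by exact: GM.
  rewrite [RHS]measure_addE [X in (X + _)%E]lawE; last exact: measurableX.
  rewrite [LHS](_ : _ = \int[P]_(w in A) \int[eta]_(u in B) fp (w, u))%E; last first.
    exact: ge0_integral_setX.
  rewrite [X in (_ + X)%E](_ : _ = \int[P]_(w in A) \int[eta]_(u in B) fn (w, u))%E; last first.
    exact: ge0_integral_setX.
  exact: integral_condlaw.
- move=> k.
  have mC : measurable (cov k : set Omega) by apply: GM; apply/mGP.
  rewrite (_ : _ (_ `*` _) = \int[P]_(w in cov k) \int[eta]_u fp (w, u))%E; last first.
    exact: ge0_integral_setX.
  have mIp' : measurable_fun setT (Ip : Omega -> \bar R).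
    exact: coarser_measurable_fun mIp.
  apply: (@le_lt_trans _ _ (\int[P]_(w in cov k) (cst k%:R%:E w))%E).
    apply: ae_ge0_le_integral => //.
    + by move=> w _; exact: integral_ge0.
    + exact: measurable_funTS.
    + by move=> w _; rewrite lee_fin.
    + by apply: filterS Ip_fin => w + [//|Iw]; rewrite Iw ltxx.
  by rewrite integral_cst// -ge0_fin_numE ?fin_numM ?fin_num_measure// mule_ge0.
Qed.

(** On {f < 0} the positive part vanishes, so by [law_decomp] the nonnegative
    measure [law_neg] vanishes there too. *)
Lemma density_ae_ge0 : {ae (P \x eta)%E, forall z, 0 <= f z}.
Proof.
pose N := [set z : OmG * R | f z < 0].
have mN : measurable N.
  have := mf measurableT (measurable_itv `]-oo, 0[); rewrite setTI.
  by congr measurable; apply/seteqP; split => z /=; rewrite in_itv.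
have mN' : measurable (psi @^-1` N) by rewrite -[X in measurable X]setTI; exact: mpsi.
have pos0 : law_pos N = 0%E.
  apply: integral0_eq => z; rewrite /psi /= /N /= => fz.
  by rewrite funeposE; apply/max_idPr; rewrite lee_fin ltW.
have neg0 : law_neg N = 0%E.
  apply/eqP; rewrite eq_le measure_ge0 andbT -pos0 law_decomp//.
  exact: leeDr.
have : (\int[P \x eta]_(z in psi @^-1` N) `|fn z| = 0)%E.
  by rewrite -[RHS]neg0; apply: eq_integral => z _; rewrite gee0_abs.
move=> /(ae_eq_integral_abs _ mN' (measurable_funTS mfn')).
apply: filterS => z h; rewrite leNgt; apply/negP => fz.
have := h fz; rewrite funenegE /= (max_idPl _); last first.
  by rewrite lee_fin oppr_ge0 ltW.
by move=> [] /eqP; rewrite oppr_eq0 => /eqP fz0; rewrite fz0 ltxx in fz.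
Qed.

Lemma law_density (D : set (OmG * R)) : measurable D ->
  P [set w | D (w, tau w)] = (\int[P \x eta]_(z in D) fp z)%E.
Proof.
move=> mD.
have mD' : measurable (psi @^-1` D).
  by rewrite -[X in measurable X]setTI; exact: mpsi.
have neg0 : law_neg D = 0%E.
  transitivity (\int[P \x eta]_(z in psi @^-1` D) (cst 0 z : \bar R))%E.
    apply: ge0_ae_eq_integral => //; first exact: measurable_funTS.
    apply: filterS density_ae_ge0 => z fz _.
    by rewrite funenegE /=; apply/max_idPr; rewrite lee_fin oppr_le0.
  exact: integral0.
by have := law_decomp mD; rewrite neg0 adde0 lawE.
Qed.

Lemma integral_law_density (g : OmG * R -> \bar R) :
  measurable_fun setT g -> (forall z, 0 <= g z)%E ->
  (\int[P]_w g (w, tau w) = \int[P \x eta]_z (fp z * g z))%E.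
Proof.
move=> mg g0.
have fp0 (z : Omega * R) : (0 <= fp z)%E by [].
have H (D : set (OmG * R)) : measurable D ->
    P (phi @^-1` D) = (\int[P \x eta]_(z in psi @^-1` D) fp z)%E.
  exact: law_density.
exact: (@integral_image_density R _ _ _ _ _ _ P (product_sfm P eta) phi psi
  _ _ mphi mpsi mfp' fp0 H mg g0).
Qed.

End joint_law.

(** Transfer from nonnegative to real-valued functions of (w, tau w). *)
Section signed_law.
Context d (Omega : measurableType d) (R : realType).
Variables (P : probability Omega R) (G : set (set Omega)).
Variables (tau : Omega -> R) (eta : {sigma_finite_measure set R -> \bar R}).
Hypothesis GM : G `<=` measurable.
Hypothesis mtau : measurable_fun setT tau.
Local Notation OmG := (g_sigma_algebraType G).

Variable a : Omega * R -> R.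
Hypothesis ma : measurable_fun setT (a : OmG * R -> R).
Hypothesis a0 : forall z, 0 <= a z.
Hypothesis lawa : forall g : OmG * R -> \bar R,
  measurable_fun setT g -> (forall z, 0 <= g z)%E ->
  (\int[P]_w g (w, tau w) = \int[P \x eta]_z ((a z)%:E * g z))%E.

Variable g : Omega * R -> R.
Hypothesis mg : measurable_fun setT (g : OmG * R -> R).

Let mphi : measurable_fun setT (fun w => (w, tau w) : OmG * R).
Proof. by apply/measurable_fun_pairP; split => //; exact: measurable_coarser. Qed.

Lemma measurable_at_tau : measurable_fun setT (fun w => g (w, tau w)).
Proof. exact: (measurableT_comp mg mphi). Qed.

Lemma integrable_at_tau :
  P.-integrable setT (fun w => (g (w, tau w))%:E) <->
  (P \x eta)%E.-integrable setT (fun z => (a z * g z)%:E).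
Proof.
have mag : measurable_fun setT (fun z : Omega * R => a z * g z).
  apply: (coarser_measurable_fun_prod GM).
  exact: (measurable_funM ma mg).
have mg1 : measurable_fun setT (fun z : OmG * R => `|(g z)%:E|%E).
  by apply: measurableT_comp => //; exact/measurable_EFinP.
have absE : (\int[P]_w `|(g (w, tau w))%:E| =
    \int[P \x eta]_z `|(a z * g z)%:E|)%E.
  rewrite (lawa mg1)//; apply: eq_integral => z _.
  by rewrite EFinM abseM [in RHS](gee0_abs (_ : 0 <= (a z)%:E)%E)// lee_fin.
split=> /integrableP[_ fin]; apply/integrableP; split.
- exact/measurable_EFinP.
- by rewrite -absE.
- by apply/measurable_EFinP; exact: measurable_at_tau.
- by rewrite absE.
Qed.

Lemma integral_at_tau :
  (\int[P]_w (g (w, tau w))%:E = \int[P \x eta]_z (a z * g z)%:E)%E.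
Proof.
have mgE : measurable_fun setT (EFin \o g : OmG * R -> \bar R).
  exact/measurable_EFinP.
rewrite integralE [RHS]integralE; congr (_ - _)%E.
- have := lawa (measurable_funepos mgE) (funepos_ge0 _).
  rewrite (eq_integral (fun w => ((EFin \o g)^\+)%E (w, tau w))); last first.
    by move=> w _; rewrite !funeposE.
  move=> ->; apply: eq_integral => z _; rewrite !funeposE /=.
  by rewrite EFinM maxe_pMr ?lee_fin// mule0.
- have := lawa (measurable_funeneg mgE) (funeneg_ge0 _).
  rewrite (eq_integral (fun w => ((EFin \o g)^\-)%E (w, tau w))); last first.
    by move=> w _; rewrite !funenegE.
  move=> ->; apply: eq_integral => z _; rewrite !funenegE /=.
  by rewrite maxe_pMr ?lee_fin// mule0 -EFinM mulrN.
Qed.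

End signed_law.

Section zero_extension.
Context d (Omega : measurableType d) (R : realType).
Implicit Types f : Omega -> R -> R.

(** Functions on Omega x R^+ are only constrained at u >= 0; extending them by 0
    gives measurable functions on the whole product. *)
Definition extend0 f : Omega * R -> R :=
  (fun z => f z.1 z.2) \_ ([set: Omega] `*` (`[0, +oo[%classic : set R)).

Lemma extend0E f w u : 0 <= u -> extend0 f (w, u) = f w u.
Proof. by move=> u0; rewrite /extend0 patchE mem_set//; split => //=; rewrite in_itv/= u0. Qed.

Lemma extend0_lt0 f w u : u < 0 -> extend0 f (w, u) = 0.
Proof.
move=> u0; rewrite /extend0 patchE memNset//= in_itv/= andbT => -[_].
by rewrite leNgt u0.
Qed.

Lemma measurable_extend0 (G : set (set Omega)) f : jointly_measurable G f ->
  measurable_fun setT (extend0 f : g_sigma_algebraType G * R -> R).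
Proof. by move=> mf; apply/(measurable_restrictT _ _).1 => //; exact: measurableX. Qed.

End zero_extension.

Section density_process.
Context d (Omega : measurableType d) (R : realType).
Variables (P : probability Omega R) (F : R -> set (set Omega)).
Variables (tau : Omega -> R) (eta : {sigma_finite_measure set R -> \bar R}).
Variable alpha : R -> Omega -> R -> R.
Hypothesis filF : is_filtration F.
Hypothesis mtau : measurable_fun setT tau.
Hypothesis tau0 : forall w, 0 < tau w.
Hypothesis dens : density_hypothesis P F tau eta alpha.
Variable s : R.
Hypothesis s0 : 0 <= s.

Local Notation OmF := (g_sigma_algebraType (F s)).

(** The positive part of alpha_s, used in place of alpha_s because it is
    nonnegative everywhere; the two agree almost everywhere
    ([nneg_density_ae]). *)
Definition nneg_density : Omega * R -> R := (extend0 (alpha s))^\+.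

Let sF : is_subsigma (F s). Proof. exact: is_subsigma_filtration. Qed.

Lemma measurable_extend0_density :
  measurable_fun setT (extend0 (alpha s) : OmF * R -> R).
Proof. by case: dens => _ _ /(_ _ s0)[/measurable_extend0]. Qed.

Let condlaw (B : set R) : measurable B ->
  {ae P, forall w, (condprob P (F s) (tau @^-1` B) w)%:E =
                   (\int[eta]_(u in B) (extend0 (alpha s) (w, u))%:E)%E}.
Proof.
move=> mB; case: dens => _ _ /(_ _ s0)[_] /(_ (B `&` `[0, +oo[%classic)).
move=> /(_ (measurableI _ _ mB (measurable_itv _)) (@subIsetr _ _ _)).
rewrite (_ : tau @^-1` (B `&` `[0, +oo[) = tau @^-1` B); last first.
  apply/seteqP; split => w /=; first by case.
  by move=> Bw; split => //; rewrite in_itv/= andbT ltW.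
apply: filterS => w ->; rewrite integral_mkcondr.
apply: eq_integral => u _; rewrite patchE /extend0 patchE /=.
have -> : ((w, u) \in [set: Omega] `*` `[0, +oo[) = (u \in (`[0, +oo[%classic : set R)).
  by apply/idP/idP; rewrite !inE => //; case.
by case: ifP.
Qed.

Lemma measurable_nneg_density : measurable_fun setT (nneg_density : OmF * R -> R).
Proof. by apply: measurable_funrpos; exact: measurable_extend0_density. Qed.

Lemma nneg_density_ge0 z : 0 <= nneg_density z. Proof. exact: funrpos_ge0. Qed.

Lemma nneg_density_ae : {ae (P \x eta)%E, forall z, extend0 (alpha s) z = nneg_density z}.
Proof.
have := density_ae_ge0 sF mtau measurable_extend0_density condlaw.
by apply: filterS => z z0; rewrite /nneg_density /funrpos (max_idPl z0).
Qed.

Lemma nneg_density_law (g : OmF * R -> \bar R) :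
  measurable_fun setT g -> (forall z, 0 <= g z)%E ->
  (\int[P]_w g (w, tau w) = \int[P \x eta]_z ((nneg_density z)%:E * g z))%E.
Proof.
move=> mg g0.
have := integral_law_density sF mtau measurable_extend0_density condlaw mg g0.
move=> ->; apply: eq_integral => z _; congr (_ * _)%E.
by rewrite funeposE /nneg_density /funrpos EFin_max.
Qed.

End density_process.

(** * Conditional expectations depending on a parameter *)

Section joint_condexp.
Context d (Omega : measurableType d) (R : realType).
Variables (P : probability Omega R) (G : set (set Omega)).
Hypothesis sG : is_subsigma G.

Local Notation OmG := (g_sigma_algebraType G).
Local Notation leb := (@lebesgue_measure R).

Let GM : G `<=` measurable. Proof. by case: sG. Qed.

Section joint_version.
Context d1 (E : measurableType d1).

(** h(., e) represents E[X(., e) | G] for every e, not only for almost every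
    one: this is preserved by the limits below without a choice of null
    sets. *)
Definition joint_version (X : Omega * E -> \bar R) (h : OmG * E -> \bar R) :=
  [/\ measurable_fun setT h, forall z, (0 <= h z)%E &
    forall (e : E) A, G A ->
      (\int[P]_(w in A) h (w, e) = \int[P]_(w in A) X (w, e))%E].

Let measurable_section (h : OmG * E -> \bar R) e :
  measurable_fun setT h ->
  measurable_fun setT (fun w : OmG => h (w, e)).
Proof. by move=> mh; exact: measurableT_comp. Qed.

Let measurable_section' (h : OmG * E -> \bar R) e :
  measurable_fun setT h ->
  measurable_fun setT (fun w : Omega => h (w, e)).
Proof.
move=> /(measurable_section e) mh.
exact: (coarser_measurable_fun GM mh).
Qed.

Let measurable_indic_section (D : set (Omega * E)) e : measurable D ->
  measurable_fun setT (fun w : Omega => (\1_D (w, e))%:E : \bar R).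
Proof.
move=> mD; apply/measurable_EFinP.
exact: (measurableT_comp (@measurable_indic _ _ R setT _ mD)
  (pair2_measurable e)).
Qed.

Lemma joint_version_rect (A : set Omega) (B : set E) :
  measurable A -> measurable B ->
  exists h, joint_version (EFin \o \1_(A `*` B)) h.
Proof.
move=> mA mB.
pose Z := condexp P G \1_A.
have XZ : is_condexp P G \1_A Z.
  by apply: is_condexp_condexp => //; exact: integrable_indic.
have [_ mZ iZ intZ] := XZ.
have Z0 : {ae P, forall w, 0 <= Z w}.
  exact: (is_condexp_ae_le sG (is_condexp_cst P G 0) XZ).
pose h (z : OmG * E) : \bar R := (Order.max (Z z.1) 0 * \1_B z.2)%:E.
have mZp : measurable_fun setT (fun w : OmG => Order.max (Z w) 0).
  exact: measurable_maxr.
exists h; split.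
- apply/measurable_EFinP; apply: measurable_funM.
    exact: (measurableT_comp mZp measurable_fst).
  exact: (measurableT_comp (@measurable_indic _ _ R setT _ mB) measurable_snd).
- by move=> z; rewrite lee_fin mulr_ge0// le_max lexx orbT.
- move=> e C GC; have mC := GM GC; rewrite /h /=.
  have [eB|eB] := boolP (e \in B); last first.
    rewrite !integral0_eq// => w _; rewrite indicE.
      by rewrite memNset// => -[_ /= eB']; move: eB; rewrite notin_setE.
    by rewrite (negbTE eB) mulr0.
  transitivity (\int[P]_(w in C) (Z w)%:E)%E.
    apply: ae_eq_integral => //.
    + apply: measurable_funTS; apply/measurable_EFinP; apply: measurable_funM => //.
      exact: coarser_measurable_fun mZp.
    + by apply: measurable_funTS; exact: measurable_int iZ.
    + by apply: filterS Z0 => w Zw _; rewrite indicE eB mulr1 (max_idPl Zw).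
  rewrite intZ//; apply: eq_integral => w _; congr (_%:E).
  rewrite !indicE (_ : (w \in A) = ((w, e) \in A `*` B))//.
  apply/idP/idP; rewrite !inE; last by case.
  by move=> Aw; split => //=; move: eB; rewrite inE.
Qed.

(** One takes 1 - h, truncated at 0 to remain nonnegative; the truncation acts on
    a null set because h(., e) <= 1 almost surely.  Finiteness of the integral of
    1_D allows the subtraction. *)
Lemma joint_version_setC (D : set (Omega * E)) : measurable D ->
  (exists h, joint_version (EFin \o \1_D) h) ->
  exists h, joint_version (EFin \o \1_(~` D)) h.
Proof.
move=> mD [h [mh h0 hD]].
exists (fun z => maxe (1 - h z) 0)%E; split.
- by apply: measurable_maxe => //; exact: emeasurable_funB.
- by move=> z; rewrite le_max lexx orbT.
move=> e A GA; have mA := GM GA.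
have mhe := @measurable_section h e mh.
have mhe' := @measurable_section' h e mh.
have iD : P.-integrable setT (fun w => (\1_D (w, e))%:E).
  rewrite (_ : (fun w => _) = EFin \o \1_(ysection D e)); last first.
    by apply/funext => w; rewrite /= !indicE mem_ysection.
  by apply: integrable_indic; exact: measurable_ysection.
have [hc hfin] := is_condexp_fine sG iD mhe (fun w => h0 _) (hD e).
have h1 : {ae P, forall w, fine (h (w, e)) <= 1}.
  apply: (is_condexp_ae_le sG hc (is_condexp_cst P G 1)) => w.
  by rewrite indicE; case: (_ \in _).
have intD1 : (\int[P]_(w in A) (\1_D (w, e))%:E < +oo)%E.
  apply: integrable_lty => //; exact: integrableS iD.
have intD0 : (0 <= \int[P]_(w in A) (\1_D (w, e))%:E)%E.
  by apply: integral_ge0 => w _; rewrite lee_fin.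
have Dfin : (\int[P]_(w in A) (\1_D (w, e))%:E)%E \is a fin_num.
  by rewrite ge0_fin_numE.
suff H : (\int[P]_(w in A) (\1_D (w, e))%:E +
    \int[P]_(w in A) maxe (1 - h (w, e)) 0 =
    \int[P]_(w in A) (\1_D (w, e))%:E +
    \int[P]_(w in A) (\1_(~` D) (w, e))%:E)%E.
  rewrite -[LHS](addeK _ Dfin) [X in (X - _)%E]addeC H.
  by rewrite [X in (X - _)%E]addeC addeK.
rewrite -[in LHS]hD// -!ge0_integralD//=; first last.
- apply: measurable_funTS; apply: measurable_maxe => //; exact: emeasurable_funB.
- by move=> w _; rewrite le_max lexx orbT.
- exact: measurable_funTS.
- by apply: measurable_funTS; apply: measurable_indic_section; exact: measurableC.
- by apply: measurable_funTS; exact: measurable_indic_section.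
transitivity (\int[P]_(w in A) (cst 1 w : \bar R))%E.
  apply: ge0_ae_eq_integral => //.
  - apply: measurable_funTS; apply: emeasurable_funD => //.
    by apply: measurable_maxe => //; exact: emeasurable_funB.
  - by move=> w _; rewrite adde_ge0// le_max lexx orbT.
  apply: filterS2 hfin h1 => w hw; move: (h0 (w, e)).
  rewrite hw => h0w h1w _ /=.
  rewrite -EFinB (max_idPl _) ?lee_fin ?subr_ge0//.
  by rewrite -EFinD addrC subrK.
apply: eq_integral => w _; rewrite !indicE in_setC.
by case: (_ \in D); rewrite /= -EFinD ?addr0 ?add0r.
Qed.

Lemma joint_version_bigcup (F : (set (Omega * E))^nat) :
  (forall n, measurable (F n)) -> trivIset setT F ->
  (forall n, exists h, joint_version (EFin \o \1_(F n)) h) ->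
  exists h, joint_version (EFin \o \1_(\bigcup_n F n)) h.
Proof.
move=> mF tF Fh; have [h hF] := choice Fh.
exists (fun z => \sum_(n <oo) h n z)%E; split.
- apply: ge0_emeasurable_sum => // [n z _ _|n _]; first by have [] := hF n.
  by have [] := hF n.
- by move=> z; apply: nneseries_ge0 => n _ _; have [] := hF n.
move=> e A GA; have mA := GM GA.
rewrite integral_nneseries//; first last.
- by move=> n w _; have [] := hF n.
- by move=> n; apply: measurable_funTS; apply: measurable_section'; have [] := hF n.
transitivity (\sum_(n <oo) \int[P]_(w in A) (\1_(F n) (w, e))%:E)%E.
  by apply: eq_eseriesr => n _; case: (hF n) => _ _ ->.
rewrite -integral_nneseries//; first last.
- by move=> n; apply: measurable_funTS; exact: measurable_indic_section.
by apply: eq_integral => w _; rewrite /= indic_bigcup.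
Qed.

Lemma joint_version_indic (D : set (Omega * E)) : measurable D ->
  exists h, joint_version (EFin \o \1_D) h.
Proof.
rewrite measurable_prod_measurableType; move: D.
apply: dynkin_induction.
- exact: measurable_prod_measurableType.
- move=> _ _ [A1 mA1 [B1 mB1 <-]] [A2 mA2 [B2 mB2 <-]]; rewrite -setXI.
  by exists (A1 `&` A2); [exact: measurableI|exists (B1 `&` B2) => //;
    exact: measurableI].
- by rewrite -setXTT; exact: joint_version_rect.
- by move=> _ [A mA [B mB <-]]; exact: joint_version_rect.
- exact: joint_version_setC.
- exact: joint_version_bigcup.
Qed.

End joint_version.

Section parametrized_condexp.
Context d1 (E : measurableType d1).

(** The layer-cake formula with the level r as an additional parameter: if h
    represents the indicators of the level sets {r < X}, then the integral of h
    over r represents X. *)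
Lemma joint_version_ge0 (X : Omega * E -> \bar R) :
  measurable_fun setT X -> (forall z, 0 <= X z)%E ->
  exists h, joint_version X h.
Proof.
move=> mX X0.
pose assoc (z : Omega * (E * R)) : (Omega * E) * R := ((z.1, z.2.1), z.2.2).
have massoc : measurable_fun setT assoc.
  apply/measurable_fun_pairP; split.
    apply/measurable_fun_pairP; split; first exact: measurable_fst.
    exact: (measurableT_comp measurable_fst measurable_snd).
  exact: (measurableT_comp measurable_snd measurable_snd).
pose D := assoc @^-1` undergraph X.
have mD : measurable D.
  by rewrite -[X in measurable X]setTI; apply: massoc => //; exact: measurable_undergraph.
have [h [mh h0 hD]] := joint_version_indic mD.
pose assoc' (z : (OmG * E) * R) : OmG * (E * R) := (z.1.1, (z.1.2, z.2)).
have massoc' : measurable_fun setT assoc'.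
  apply/measurable_fun_pairP; split.
    exact: (measurableT_comp measurable_fst measurable_fst).
  apply/measurable_fun_pairP; split; last exact: measurable_snd.
  exact: (measurableT_comp measurable_snd measurable_fst).
have mh' : measurable_fun setT (h \o assoc') by exact: measurableT_comp.
exists (fun z => \int[leb]_r (h \o assoc') (z, r))%E; split.
- by apply: (@measurable_fun_fubini_tonelli_F _ _ _ _ R leb _ mh') => z; exact: h0.
- by move=> z; apply: integral_ge0 => r _; exact: h0.
move=> e A GA; have mA := GM GA.
have mhe : measurable_fun setT (fun z : Omega * R => h (z.1, (e, z.2))).
  have mp : measurable_fun setT (fun z : Omega * R => (z.1 : OmG, (e, z.2))).
    apply/measurable_fun_pairP; split.
      exact: (measurableT_comp (measurable_coarser GM) measurable_fst).
    apply/measurable_fun_pairP; split; [exact: measurable_cst|exact: measurable_snd].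
  exact: (measurableT_comp mh mp).
rewrite (ge0_fubini_tonelli_set P leb mA mhe)//.
under eq_integral do rewrite /= hD//.
have mU : measurable_fun setT
    (fun z : Omega * R => (\1_(undergraph X) ((z.1, e), z.2))%:E : \bar R).
  have mp : measurable_fun setT (fun z : Omega * R => ((z.1, e), z.2)).
    apply/measurable_fun_pairP; split; last exact: measurable_snd.
    apply/measurable_fun_pairP; split; [exact: measurable_fst|exact: measurable_cst].
  apply/measurable_EFinP.
  exact: (measurableT_comp (@measurable_indic _ _ R setT _
    (measurable_undergraph mX)) mp).
rewrite -(ge0_fubini_tonelli_set P leb mA mU)//.
by apply: eq_integral => w _; rewrite /= layer_cake.
Qed.

Lemma joint_condexp (X : Omega * E -> R) : measurable_fun setT X ->
  exists H : Omega * E -> R,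
    measurable_fun setT (H : OmG * E -> R) /\
    forall e, P.-integrable setT (fun w => (X (w, e))%:E) ->
      is_condexp P G (fun w => X (w, e)) (fun w => H (w, e)).
Proof.
move=> mX.
have [|z|hp [mhp hp0 hpX]] := @joint_version_ge0 (EFin \o X^\+).
  by apply/measurable_EFinP; exact: measurable_funrpos.
  by rewrite lee_fin funrpos_ge0.
have [|z|hn [mhn hn0 hnX]] := @joint_version_ge0 (EFin \o X^\-).
  by apply/measurable_EFinP; exact: measurable_funrneg.
  by rewrite lee_fin funrneg_ge0.
exists (fun z => fine (hp z) - fine (hn z)); split.
  apply: measurable_funB.
    exact: (measurableT_comp (@fine_measurable R setT measurableT) mhp).
  exact: (measurableT_comp (@fine_measurable R setT measurableT) mhn).
move=> e iX.
have ip : P.-integrable setT (EFin \o (fun w => X^\+ (w, e))).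
  exact: (@integrable_funrpos _ _ R P setT (fun w => X (w, e))).
have im : P.-integrable setT (EFin \o (fun w => X^\- (w, e))).
  exact: (@integrable_funrneg _ _ R P setT (fun w => X (w, e))).
have mse (h : OmG * E -> \bar R) : measurable_fun setT h ->
    measurable_fun setT (fun w : OmG => h (w, e)).
  by move=> mh; exact: measurableT_comp.
have [cp _] := is_condexp_fine sG ip (mse _ mhp) (fun w => hp0 _) (hpX e).
have [cn _] := is_condexp_fine sG im (mse _ mhn) (fun w => hn0 _) (hnX e).
have := is_condexpB sG cp cn.
rewrite (_ : _ \- _ = fun w => X (w, e))//.
by apply/funext => w; rewrite -[in RHS](funrposBneg X).
Qed.

End parametrized_condexp.
End joint_condexp.

(** * The conditional expectation of the claim *)

Section default_model.
Context d (Omega : measurableType d) (R : realType).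
Variables (P : probability Omega R) (F : R -> set (set Omega)).
Variables (tau : Omega -> R) (eta : {sigma_finite_measure set R -> \bar R}).
Variables (alpha : R -> Omega -> R -> R) (T t : R) (Y : Omega -> R -> R) (C : R).
Hypothesis filF : is_filtration F.
Hypothesis mtau : measurable_fun setT tau.
Hypothesis tau0 : forall w, 0 < tau w.
Hypothesis dens : density_hypothesis P F tau eta alpha.
Hypothesis T0 : 0 <= T.
Hypothesis mY : jointly_measurable (F T) Y.
Hypothesis YC : forall w u, 0 <= u -> `|Y w u| <= C.
Hypotheses (t0 : 0 <= t) (tT : t <= T).

Local Notation OmFt := (g_sigma_algebraType (F t)).
Local Notation OmFT := (g_sigma_algebraType (F T)).
Local Notation at_ := (nneg_density alpha t).
Local Notation aT := (nneg_density alpha T).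

Let sFt : is_subsigma (F t). Proof. exact: is_subsigma_filtration. Qed.
Let sFT : is_subsigma (F T). Proof. exact: is_subsigma_filtration. Qed.
Let FtM : F t `<=` measurable. Proof. by case: sFt. Qed.
Let FTM : F T `<=` measurable. Proof. by case: sFT. Qed.

Let mFt A : measurable (A : set OmFt) <-> F t A.
Proof. by apply: measurable_g_sigmaP; case: sFt. Qed.

Let mFT A : measurable (A : set OmFT) <-> F T A.
Proof. by apply: measurable_g_sigmaP; case: sFT. Qed.

Let FtT : F t `<=` F T.
Proof. by case: filF => _ _; exact. Qed.

Let measurable_FtT d' (U : measurableType d') (g : Omega * R -> U) :
  measurable_fun setT (g : OmFt * R -> U) ->
  measurable_fun setT (g : OmFT * R -> U).
Proof.
move=> mg; have sub : F t `<=` (@measurable _ OmFT) by move=> A /FtT /mFT.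
exact: (@coarser_measurable_fun_prod _ OmFT (F t) _ _ _ _ g sub mg).
Qed.

Let measurable_set_FtT (D : set (Omega * R)) :
  measurable (D : set (OmFt * R)) -> measurable (D : set (OmFT * R)).
Proof.
move=> mD; apply/(@measurable_indicP _ _ R).
by apply: measurable_FtT; exact: measurable_indic.
Qed.

Let measurable_set_FT (D : set (Omega * R)) :
  measurable (D : set (OmFT * R)) -> measurable D.
Proof.
move=> mD; apply/(@measurable_indicP _ _ R).
by apply: (coarser_measurable_fun_prod FTM); exact: measurable_indic.
Qed.

Definition claim_density : Omega * R -> R := fun z => extend0 Y z * extend0 (alpha T) z.
Local Notation X := claim_density.

Let mX : measurable_fun setT (X : OmFT * R -> R).
Proof.
apply: measurable_funM; first exact: measurable_extend0.
exact: (measurable_extend0_density dens).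
Qed.

Lemma measurable_claim_density : measurable_fun setT X.
Proof. exact: (coarser_measurable_fun_prod FTM mX). Qed.
Let mX' := measurable_claim_density.

Let extendY_tau w : extend0 Y (w, tau w) = Y w (tau w).
Proof. by rewrite extend0E// ltW. Qed.

Lemma integrable_claim : P.-integrable setT (fun w => (Y w (tau w))%:E).
Proof.
rewrite (_ : (fun w => _) = EFin \o (fun w => extend0 Y (w, tau w))); last first.
  by apply/funext => w; rewrite /= extendY_tau.
apply: (@le_integrable _ _ _ _ _ _ _ (EFin \o cst C)) => //.
- apply/measurable_EFinP.
  exact: (measurable_at_tau FTM mtau (measurable_extend0 mY)).
- move=> w _; rewrite /= lee_fin extendY_tau (le_trans (YC _ _)) ?ler_norm//.
  exact: ltW.
- exact: finite_measure_integrable_cst.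
Qed.

Let aTX : {ae (P \x eta)%E, forall z, aT z * extend0 Y z = X z}.
Proof.
have := nneg_density_ae filF mtau tau0 dens T0.
by apply: filterS => z <-; rewrite mulrC.
Qed.

Let nneg_density_lawt := nneg_density_law filF mtau tau0 dens t0.
Let nneg_density_lawT := nneg_density_law filF mtau tau0 dens T0.
Let mat := measurable_nneg_density dens t0.
Let maT := measurable_nneg_density dens T0.

Lemma integrable_claim_density : (P \x eta)%E.-integrable setT (EFin \o X).
Proof.
have : P.-integrable setT (fun w => (extend0 Y (w, tau w))%:E).
  by under eq_fun do rewrite extendY_tau; exact: integrable_claim.
move/(integrable_at_tau FTM mtau maT (@nneg_density_ge0 _ _ _ alpha T) nneg_density_lawT
  (measurable_extend0 mY)).
apply: ae_eq_integrable; first exact/measurable_EFinP.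
by apply: filterS aTX => z zX; rewrite zX.
Qed.
Let iX := integrable_claim_density.

(** The joint law at time T, with Y_T alpha_T in place of Y_T times the positive
    part of alpha_T, to which it is equal almost everywhere. *)
Lemma integral_claim (D : set (Omega * R)) :
  measurable (D : set (OmFT * R)) ->
  (\int[P]_w (\1_D (w, tau w) * Y w (tau w))%:E =
   \int[P \x eta]_z (\1_D z * X z)%:E)%E.
Proof.
move=> mD; have mD' := measurable_set_FT mD.
pose g z := \1_D z * extend0 Y z.
have mg : measurable_fun setT (g : OmFT * R -> R).
  by apply: measurable_funM; [exact: measurable_indic|exact: measurable_extend0].
have := integral_at_tau (@nneg_density_ge0 _ _ _ alpha T) nneg_density_lawT mg.
rewrite /g; under eq_integral do rewrite extendY_tau.
move=> ->; apply: ae_eq_integral => //.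
- apply/measurable_EFinP; apply: (coarser_measurable_fun_prod FTM).
  exact: measurable_funM.
- apply/measurable_EFinP; apply: measurable_funM => //; exact: measurable_indic.
- by apply: filterS aTX => z zX _; rewrite mulrCA zX.
Qed.

(** (w, tau w) has density alpha_t, so it does not charge {alpha_t <= 0}. *)
Lemma nneg_density_tau_gt0 : {ae P, forall w, 0 < at_ (w, tau w)}.
Proof.
pose D := [set z | at_ z <= 0].
have mD : measurable (D : set (OmFt * R)).
  have := mat measurableT (measurable_itv `]-oo, 0]); rewrite setTI.
  by congr measurable; apply/seteqP; split => z /=; rewrite in_itv.
have mg : measurable_fun setT (EFin \o \1_D : OmFt * R -> \bar R).
  by apply/measurable_EFinP; exact: measurable_indic.
have := nneg_density_lawt mg (fun z => _); rewrite [X in _ -> _ = X]integral0_eq; last first.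
  move=> z _ /=; rewrite -EFinM indicE.
  have [|] := boolP (z \in D); last by rewrite mulr0.
  rewrite inE /D /= => az; rewrite mulr1; congr (_%:E).
  by apply/le_anti; rewrite az nneg_density_ge0.
move=> H; have {H} : (\int[P]_w `|(\1_D (w, tau w))%:E : \bar R| = 0)%E.
  rewrite -[RHS]H; last by move=> z; rewrite lee_fin.
  by apply: eq_integral => w _; rewrite gee0_abs// lee_fin.
have m1 : measurable_fun setT (fun w => (\1_D (w, tau w))%:E : \bar R).
  apply/measurable_EFinP.
  by apply: (measurable_at_tau FtM mtau); exact: measurable_indic.
move=> /(ae_eq_integral_abs _ measurableT m1); apply: filterS => w /(_ I) /=.
move=> [] /eqP; rewrite indicE pnatr_eq0 eqb0 notin_setE /D /= => /negP.
by rewrite -ltNge.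
Qed.

Section after_default.
Variable Yad : Omega -> R -> R.
Hypothesis HYad : is_after_default P F eta alpha T t Y Yad.

Local Notation Z u := (condexp P (F t) (fun w => Y w u * alpha T w u)).

Let mYad : measurable_fun setT (extend0 Yad : OmFt * R -> R).
Proof. by case: HYad => /measurable_extend0. Qed.

Let g (z : Omega * R) := at_ z * extend0 Yad z.

Let mg : measurable_fun setT (g : OmFt * R -> R).
Proof. exact: measurable_funM. Qed.

Let mg' : measurable_fun setT g.
Proof. exact: (coarser_measurable_fun_prod FtM mg). Qed.

Let pos : set (Omega * R) := [set z | 0 < at_ z].

Let mpos : measurable (pos : set (OmFt * R)).
Proof.
have := mat measurableT (measurable_itv `]0, +oo[); rewrite setTI.
by congr measurable; apply/seteqP; split => z /=; rewrite in_itv/= andbT.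
Qed.

Let section_measurable (D : set (Omega * R)) u :
  measurable (D : set (OmFt * R)) -> F t (ysection D u).
Proof. by move=> mD; apply/mFt; exact: measurable_ysection. Qed.

Let claim_section u : 0 <= u ->
  (fun w => X (w, u)) = (fun w => Y w u * alpha T w u).
Proof. by move=> u0; apply/funext => w; rewrite /claim_density !extend0E. Qed.

(** Multiplying Yad by alpha_t clears its denominator. *)
Let after_section : {ae eta, forall u, 0 <= u ->
  is_condexp P (F t) (fun w => X (w, u)) (Z u) /\
  {ae P, forall w, g (w, u) = \1_(ysection pos u) w * Z u w}}.
Proof.
have iXu := ae_integrable2 iX.
case: HYad => _; apply: filterS2 iXu => u iXu Hu u0; split.
  have := @is_condexp_condexp _ _ _ P _ sFt (fun w => X (w, u)) iXu.
  by rewrite {2}claim_section.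
apply: filterS Hu => w Hw; rewrite /g extend0E// Hw !indicE mem_ysection.
have posE : ((w, u) \in pos) = (0 < alpha t w u).
  by apply/idP/idP; rewrite inE /pos /= /nneg_density /funrpos extend0E// lt_max ltxx orbF.
have setE : (w \in [set w' | 0 < alpha t w' u]) = (0 < alpha t w u).
  by apply/idP/idP; rewrite inE.
rewrite posE setE /nneg_density /funrpos extend0E//.
have [a0|a0] := ltP 0 (alpha t w u).
  by rewrite mulr1 mul1r mulrCA divff ?mulr1// gt_eqF.
by rewrite !mul0r.
Qed.

(** The bound that makes Yad alpha_t integrable: Yad itself is not known to be
    bounded, but conditional expectation does not increase the L1 norm. *)
Let section_ineq : {ae eta, forall u,
  (\int[P]_w `|(g (w, u))%:E| <= \int[P]_w `|(X (w, u))%:E|)%E}.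
Proof.
apply: filterS after_section => u Hu.
have [u0|u0] := ltP u 0.
  rewrite integral0_eq ?integral_ge0// => w _.
  by rewrite /g /nneg_density /funrpos extend0_lt0// maxxx mul0r abse0.
have [XZ gE] := Hu u0.
apply: le_trans (is_condexp_contraction sFt XZ).
have [_ _ iZ _] := XZ.
apply: ae_ge0_le_integral => //.
- apply: measurableT_comp => //; apply/measurable_EFinP.
  exact: measurableT_comp.
- by apply: measurableT_comp => //; exact: measurable_int iZ.
apply: filterS gE => w -> _; rewrite !abse_EFin lee_fin normrM indicE.
by case: (_ \in _); rewrite ?normr1 ?mul1r// normr0 mul0r.
Qed.

(** D and {alpha_t > 0} have sections in F_t, so the conditional expectation in
    Yad can be replaced by its argument. *)
Let section_eq : {ae eta, forall u, forall D : set (Omega * R),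
  measurable (D : set (OmFt * R)) ->
  (\int[P]_w (\1_D (w, u) * g (w, u))%:E =
   \int[P]_w (\1_(D `&` pos) (w, u) * X (w, u))%:E)%E}.
Proof.
apply: filterS after_section => u Hu D mD.
have [u0|u0] := ltP u 0.
  rewrite !integral0_eq// => w _.
    by rewrite /claim_density extend0_lt0// mul0r mulr0.
  by rewrite /g /nneg_density /funrpos extend0_lt0// maxxx mul0r mulr0.
have [XZ gE] := Hu u0; have [iXu mZ iZ intZ] := XZ.
have mDp : measurable (D `&` pos : set (OmFt * R)) by exact: measurableI.
have FDp := section_measurable u mDp.
have mDp' := FtM FDp.
have iE (B : set (Omega * R)) w : \1_B (w, u) = \1_(ysection B u) w :> R.
  by rewrite !indicE mem_ysection.
under [RHS]eq_integral do rewrite iE.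
rewrite integral_indicM -intZ// -[RHS]integral_indicM.
apply: ae_eq_integral => //.
- apply/measurable_EFinP; apply: measurable_funM.
    under eq_fun do rewrite iE; apply: measurable_indic; apply: FtM.
    exact: section_measurable.
  exact: measurableT_comp.
- apply/measurable_EFinP; apply: measurable_funM => //.
  by apply/measurable_EFinP; exact: measurable_int iZ.
apply: filterS gE => w -> _; rewrite iE mulrA; congr (_ * _)%:E.
by rewrite !indicE !mem_ysection in_setI; do 2 case: (_ \in _); rewrite ?mulr1 ?mulr0 ?mul0r.
Qed.

Lemma integrable_density_after : (P \x eta)%E.-integrable setT (EFin \o g).
Proof.
apply/integrable21ltyP; first exact/measurable_EFinP.
have /(integrable21ltyP P eta) Xfin := iX.
have mabs (k : Omega * R -> R) : measurable_fun setT k ->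
    measurable_fun setT (fun z => `|(k z)%:E|%E).
  by move=> mk; apply: measurableT_comp => //; exact/measurable_EFinP.
apply: le_lt_trans (Xfin _); last exact/measurable_EFinP.
apply: ae_ge0_le_integral => //.
- by move=> u _; exact: integral_ge0.
- by apply: (@measurable_fun_fubini_tonelli_G _ _ _ _ R P (fun z => `|(g z)%:E|%E)) => //; exact: mabs.
- by move=> u _; exact: integral_ge0.
- by apply: (@measurable_fun_fubini_tonelli_G _ _ _ _ R P (fun z => `|(X z)%:E|%E)) => //; exact: mabs.
- by apply: filterS section_ineq.
Qed.

Lemma integrable_after : P.-integrable setT (fun w => (Yad w (tau w))%:E).
Proof.
have := (integrable_at_tau FtM mtau mat (@nneg_density_ge0 _ _ _ alpha t) nneg_density_lawt
  mYad).2 integrable_density_after.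
by under eq_fun do rewrite extend0E ?ltW//.
Qed.

(** Joint law at time t, then [section_eq], then joint law at time T. *)
Lemma integral_after (D : set (Omega * R)) :
  measurable (D : set (OmFt * R)) ->
  (\int[P]_w (\1_D (w, tau w) * Yad w (tau w))%:E =
   \int[P]_w (\1_D (w, tau w) * Y w (tau w))%:E)%E.
Proof.
move=> mD.
have mD' : measurable D by apply: measurable_set_FT; exact: measurable_set_FtT.
have mDp : measurable (D `&` pos : set (OmFt * R)) by exact: measurableI.
have mDp' : measurable (D `&` pos).
  by apply: measurable_set_FT; exact: measurable_set_FtT.
transitivity (\int[P \x eta]_z (\1_D z * g z)%:E)%E.
  have mk : measurable_fun setT ((fun z => \1_D z * extend0 Yad z) : OmFt * R -> R).
    by apply: measurable_funM => //; exact: measurable_indic.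
  have := integral_at_tau (@nneg_density_ge0 _ _ _ alpha t) nneg_density_lawt mk.
  under eq_integral do rewrite extend0E ?ltW//.
  by move=> ->; apply: eq_integral => z _; rewrite mulrCA.
rewrite -integral21_prod_meas1; last first.
  exact: integrable_indicM integrable_density_after.
transitivity (\int[P \x eta]_z (\1_(D `&` pos) z * X z)%:E)%E.
  rewrite -[RHS]integral21_prod_meas1; last exact: integrable_indicM iX.
  have mG (B : set (Omega * R)) (k : Omega * R -> R) : measurable B ->
      (P \x eta)%E.-integrable setT (EFin \o k) ->
      measurable_fun setT (fubini_G P (fun z => (\1_B z * k z)%:E)).
    by move=> mB ik; apply: (@measurable_fubini_G _ _ _ _ R P eta);
      exact: integrable_indicM ik.
  apply: ae_eq_integral => //.
  - exact: mG integrable_density_after.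
  - exact: mG iX.
  - by apply: filterS section_eq => u Hu _; exact: Hu.
rewrite -integral_claim; last exact: measurable_set_FtT.
apply: ae_eq_integral => //.
- apply/measurable_EFinP; apply: measurable_funM.
    apply: (measurable_at_tau FTM mtau); apply: measurable_indic.
    exact: measurable_set_FtT.
  by apply/measurable_EFinP; exact: measurable_int integrable_claim.
- apply/measurable_EFinP; apply: measurable_funM.
    apply: (measurable_at_tau FTM mtau); apply: measurable_indic.
    exact: measurable_set_FtT.
  by apply/measurable_EFinP; exact: measurable_int integrable_claim.
apply: filterS nneg_density_tau_gt0 => w wpos _; congr (_ * _)%:E.
rewrite !indicE in_setI (_ : ((w, tau w) \in pos) = true) ?andbT//.
by apply: mem_set.
Qed.

End after_default.

Lemma exists_after_default : exists Yad, is_after_default P F eta alpha T t Y Yad.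
Proof.
have [H [mH XH]] := joint_condexp P sFt mX'.
exists (fun w u => H (w, u) * posinv (extend0 (alpha t) (w, u))); split.
  apply: measurable_funTS.
  rewrite (_ : (fun z => _) = fun z : Omega * R => H z * posinv (extend0 (alpha t) z)); last first.
    by apply/funext => -[].
  apply: measurable_funM => //.
  exact: (measurableT_comp (@measurable_posinv R) (measurable_extend0_density dens t0)).
have eta_ge0 : {ae eta, forall u, 0 <= u}.
  case: dens => eta0 _ _; exists `]-oo, 0[%classic; split => //.
  by move=> u /= /negP; rewrite -ltNge in_itv.
have iXu := ae_integrable2 iX.
apply: filterS2 eta_ge0 iXu => u u0 iXu.
have XE : (fun w => X (w, u)) = (fun w => Y w u * alpha T w u).
  by apply/funext => w; rewrite /claim_density !extend0E.
have XZ := @is_condexp_condexp _ _ _ P _ sFt (fun w => X (w, u)) iXu.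
apply: filterS (is_condexp_ae_eq sFt (XH u iXu) XZ) => w ->.
rewrite XE extend0E// -mulrA; congr (_ * _).
have setE : (w \in [set w' | 0 < alpha t w' u]) = (0 < alpha t w u).
  by apply/idP/idP; rewrite inE.
by rewrite indicE setE /posinv; case: ifP; rewrite ?mulr1 ?mulr0.
Qed.

Section before_default.

Local Notation S := (survival P F tau t).
Local Notation Q := (fun w => Rintegral eta `]t, +oo[%classic
  (fun u => Y w u * alpha T w u)).
Local Notation N := (condexp P (F t) Q).

(** Ybd, extended by 0 outside {S_t > 0}, where its value is free. *)
Definition before_version : Omega -> R := fun w => N w * posinv (S w).
Local Notation q := before_version.

Let surv : set Omega := [set w | t < tau w].

Let msurv : measurable surv.
Proof.
have := mtau measurableT (measurable_itv `]t, +oo[); rewrite setTI.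
by congr measurable; apply/seteqP; split => w /=; rewrite in_itv/= andbT.
Qed.

Let S_condexp : is_condexp P (F t) \1_surv S.
Proof. by apply: (is_condexp_condexp sFt); exact: integrable_indic. Qed.

Let V : set (Omega * R) := [set z | t < z.2].

Let mV d' (T' : measurableType d') : measurable ([set z | t < z.2] : set (T' * R)).
Proof.
have := @measurable_snd _ _ T' R measurableT _ (measurable_itv `]t, +oo[).
by rewrite setTI; congr measurable; apply/seteqP; split => z /=; rewrite in_itv/= andbT.
Qed.

Let iVX : (P \x eta)%E.-integrable setT (fun z => (\1_V z * X z)%:E).
Proof. by apply: integrable_indicM => //; exact: mV. Qed.

Let Fq (w : Omega) : \bar R := (\int[eta]_u (\1_V (w, u) * X (w, u))%:E)%E.

Let iFq : P.-integrable setT Fq.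
Proof. exact: (integrable_fubini_F iVX). Qed.

Let QE w : Q w = fine (Fq w).
Proof.
congr fine; rewrite integral_mkcond; apply: eq_integral => u _.
rewrite patchE /V indicE.
have -> : ((w, u) \in [set z : Omega * R | t < z.2]) =
    (u \in (`]t, +oo[%classic : set R)).
  by apply/idP/idP; rewrite !inE /= in_itv/= andbT.
case: ifPn; rewrite ?mul0r ?mul1r// inE /= in_itv/= andbT => tu.
by rewrite /claim_density !extend0E//; apply: (le_trans t0 (ltW tu)).
Qed.

Let QFq : {ae P, forall w, Fq w = (Q w)%:E}.
Proof.
apply: filterS (integrable_ae measurableT iFq) => w /(_ I) Fw.
by rewrite QE fineK.
Qed.

Let mQ : measurable_fun setT Q.
Proof.
rewrite (_ : Q = fine \o Fq); last by apply/funext => w; rewrite QE.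
exact: (measurableT_comp (@fine_measurable R setT measurableT)
  (measurable_int P iFq)).
Qed.

Let iQ : P.-integrable setT (EFin \o Q).
Proof. by apply: ae_eq_integrable iFq => //; exact/measurable_EFinP. Qed.

Let N_condexp : is_condexp P (F t) Q N.
Proof. exact: (is_condexp_condexp sFt). Qed.

Lemma measurable_before_version : measurable_fun setT (q : OmFt -> R).
Proof.
have [_ mN _ _] := N_condexp; have [_ mS _ _] := S_condexp.
by apply: measurable_funM => //; exact: (measurableT_comp (@measurable_posinv R) mS).
Qed.
Let mq := measurable_before_version.

Let pos : set Omega := [set w | 0 < S w].

Let Fpos : F t pos.
Proof.
have [_ mS _ _] := S_condexp; apply/mFt.
have := mS measurableT _ (measurable_itv `]0, +oo[); rewrite setTI.
by congr measurable; apply/seteqP; split => w /=; rewrite in_itv/= andbT.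
Qed.

Let qS w : q w * S w = \1_pos w * N w.
Proof.
have posE : (w \in pos) = (0 < S w) by apply/idP/idP; rewrite inE.
rewrite /before_version /posinv indicE posE; case: ltP => S0.
  by rewrite -mulrA mulVf ?mulr1 ?mul1r// gt_eqF.
by rewrite mulr0 !mul0r.
Qed.

(** The integrals over {S_t <= 0} of S_t, nonpositive, and of 1_{t < tau} are
    equal. *)
Lemma survival_gt0 : {ae P, forall w, t < tau w -> 0 < S w}.
Proof.
have [iI mS iS intS] := S_condexp.
have FposC : F t (~` pos) by apply/mFt; apply: measurableC; apply/mFt.
have mposC := FtM FposC.
have null : P (surv `&` ~` pos) = 0%E.
  apply/eqP; rewrite eq_le measure_ge0 andbT.
  have := intS _ FposC; rewrite integral_indic// => <-.
  apply: (@le_trans _ _ (\int[P]_(w in ~` pos) (cst 0 w : \bar R))%E).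
    apply: le_integral => //.
    - exact: (integrableS measurableT mposC (@subsetT _ _) iS).
    - exact: (finite_measure_integrable_cst P 0 mposC).
    - move=> w; rewrite inE /pos /= => /negP.
      by rewrite -leNgt lee_fin.
  by rewrite integral0.
exists (surv `&` ~` pos); split => //; first exact: measurableI.
by move=> w /= /not_implyP[].
Qed.

(** S_t is also the integral of alpha_t over ]t, +oo[. *)
Let at_V : {ae P, forall w,
  (\int[eta]_u (at_ (w, u) * \1_V (w, u))%:E = (S w)%:E)%E}.
Proof.
have iE w u : \1_V (w, u) = \1_(`]t, +oo[%classic : set R) u :> R.
  rewrite !indicE; congr (_%:R); congr nat_of_bool.
  by apply/idP/idP; rewrite !inE /V /= in_itv/= andbT.
have [_ _ /(_ _ t0)[_ /(_ `]t, +oo[%classic)]] := dens.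
move=> /(_ (measurable_itv _)) Hdens.
have sub : (`]t, +oo[%classic : set R) `<=` `[0, +oo[%classic.
  by move=> u /=; rewrite !in_itv/= !andbT => /ltW; exact: le_trans.
have {Hdens} := Hdens sub.
rewrite (_ : tau @^-1` `]t, +oo[ = surv); last first.
  by apply/seteqP; split => w /=; rewrite in_itv/= andbT.
have atE := ae_product_section (nneg_density_ae filF mtau tau0 dens t0).
apply: filterS2 atE => w atE ->.
have mw (k : Omega * R -> R) : measurable_fun setT (k : OmFt * R -> R) ->
    measurable_fun setT (fun u => k (w, u)).
  by move=> mk; apply: (measurableT_comp (coarser_measurable_fun_prod FtM mk)).
rewrite [RHS]integral_mkcond; apply: ae_eq_integral => //.
- apply/measurable_EFinP; apply: measurable_funM; first exact: mw.
  by under eq_fun do rewrite iE; exact: measurable_indic.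
- apply/(measurable_restrictT _ _).1 => //.
  apply: (@eq_measurable_fun _ _ _ _ _ (fun u => (extend0 (alpha t) (w, u))%:E)).
    move=> u; rewrite inE => /sub; rewrite /= in_itv/= andbT => u0.
    by rewrite extend0E.
  apply: measurable_funTS; apply/measurable_EFinP; apply: mw.
  exact: (measurable_extend0_density dens t0).
apply: filterS atE => u <- _; rewrite iE patchE indicE.
case: ifPn => tu; rewrite ?mulr0// mulr1.
move: tu; rewrite inE => /sub; rewrite /= in_itv/= andbT => u0.
by rewrite extend0E.
Qed.

Let g (z : Omega * R) : R := \1_V z * q z.1.

Let mg : measurable_fun setT (g : OmFt * R -> R).
Proof.
apply: measurable_funM; first by apply: measurable_indic; exact: mV.
exact: (measurableT_comp mq measurable_fst).
Qed.

Let at_V_section w : measurable_fun setT (fun u => (at_ (w, u) * \1_V (w, u))%:E).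
Proof.
have mk : measurable_fun setT ((fun z => at_ z * \1_V z) : OmFt * R -> R).
  by apply: measurable_funM => //; apply: measurable_indic; exact: mV.
apply/measurable_EFinP.
exact: (measurableT_comp (coarser_measurable_fun_prod FtM mk) (pair1_measurable w)).
Qed.

Let at_V_ge0 w u : 0 <= at_ (w, u) * \1_V (w, u).
Proof. by rewrite mulr_ge0// nneg_density_ge0. Qed.

(** Integrating in u first produces |Ybd| S_t <= |N|. *)
Let integrable_before_density :
  (P \x eta)%E.-integrable setT (fun z => (at_ z * g z)%:E).
Proof.
have mk : measurable_fun setT (fun z : Omega * R => (at_ z * g z)%:E).
  apply/measurable_EFinP; apply: (coarser_measurable_fun_prod FtM).
  exact: measurable_funM.
apply/integrable12ltyP => //.
have [_ _ iN _] := N_condexp.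
have /integrableP[mN Nfin] := iN; apply: le_lt_trans Nfin.
apply: ae_ge0_le_integral => //.
- by move=> w _; exact: integral_ge0.
- apply: (@measurable_fun_fubini_tonelli_F _ _ _ _ R eta
    (fun z => `|(at_ z * g z)%:E|%E)) => //.
  exact: measurableT_comp.
- exact: measurableT_comp.
apply: filterS at_V => w HS _.
rewrite (eq_integral (fun u => `|(q w)%:E| * (at_ (w, u) * \1_V (w, u))%:E)%E); last first.
  move=> u _; rewrite !abse_EFin -EFinM /g mulrA normrM mulrC.
  by rewrite (ger0_norm (at_V_ge0 w u)).
rewrite ge0_integralZl//; last by move=> u _; rewrite lee_fin.
rewrite HS -[leLHS]gee0_abs ?abseM; last first.
  by rewrite mule_ge0// -HS; apply: integral_ge0 => u _; rewrite lee_fin.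
rewrite abse_id -abseM -EFinM qS !abse_EFin lee_fin normrM indicE.
by case: (_ \in _); rewrite ?normr1 ?mul1r// normr0 mul0r.
Qed.

Lemma integrable_before :
  P.-integrable setT (fun w => (\1_[set w | t < tau w] w * q w)%:E).
Proof.
exact: ((integrable_at_tau FtM mtau mat (@nneg_density_ge0 _ _ _ alpha t) nneg_density_lawt
  mg).2 integrable_before_density).
Qed.

(** Integrate in u first: the density alpha_t produces S_t, which cancels the
    denominator of Ybd; the conditional expectation N is then tested on the event
    A and {S_t > 0} of F_t, and the joint law at time T gives back Y_T(tau). *)
Lemma integral_before (A : set Omega) : F t A ->
  (\int[P]_w (\1_A w * (\1_[set w | t < tau w] w * q w))%:E =
   \int[P]_w (\1_A w * (\1_[set w | t < tau w] w * Y w (tau w)))%:E)%E.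
Proof.
move=> FA; have mA := FtM FA.
have mA1 : measurable (A `*` setT : set (OmFt * R)).
  by apply: measurableX => //; exact/mFt.
have iA1 w u : \1_(A `*` setT) (w, u) = \1_A w :> R.
  rewrite !indicE; congr (_%:R); congr nat_of_bool.
  by apply/idP/idP; rewrite !inE => //; case.
have FAp : F t (A `&` pos).
  by apply/mFt; apply: measurableI; exact/mFt.
have mAp := FtM FAp.
have [_ mN iN intN] := N_condexp.
transitivity (\int[P]_w (\1_(A `&` pos) w * N w)%:E)%E.
  pose k z := \1_(A `*` setT) z * g z.
  have mk : measurable_fun setT (k : OmFt * R -> R).
    by apply: measurable_funM => //; exact: measurable_indic.
  have := integral_at_tau (@nneg_density_ge0 _ _ _ alpha t) nneg_density_lawt mk.
  rewrite /k; under eq_integral do rewrite iA1.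
  move=> ->.
  have iAg : (P \x eta)%E.-integrable setT
      (fun z => (\1_(A `*` setT) z * (at_ z * g z))%:E).
    by apply: integrable_indicM => //; exact: measurableX.
  under eq_integral do rewrite mulrCA.
  rewrite -integral12_prod_meas1//.
  apply: ae_eq_integral => //.
  - exact: (measurable_fubini_F iAg).
  - exact: (measurable_int P (integrable_indicM mAp iN)).
  apply: filterS at_V => w HS _; rewrite /fubini_F.
  rewrite (eq_integral (fun u => (\1_A w * q w)%:E *
      (at_ (w, u) * \1_V (w, u))%:E)%E); last first.
    by move=> u _; rewrite iA1 /g /= -EFinM; congr EFin; ring.
  rewrite integralZl//; last first.
    apply/integrableP; split=> //.
    under eq_integral do rewrite gee0_abs ?lee_fin//.
    by rewrite HS ltry.
  rewrite HS -EFinM -mulrA qS mulrA; congr (_ * _)%:E.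
  by rewrite !indicE in_setI; do 2 case: (_ \in _); rewrite ?mulr1 ?mulr0 ?mul0r.
rewrite integral_indicM intN// -integral_indicM.
pose D := [set z : Omega * R | (A `&` pos) z.1] `&` V.
have mD : measurable (D : set (OmFT * R)).
  apply: measurable_set_FtT; apply: measurableI; last exact: mV.
  have -> : [set z : Omega * R | (A `&` pos) z.1] = (A `&` pos) `*` setT.
    by apply/seteqP; split => -[w u] //= -[].
  by apply: measurableX => //; exact/mFt.
have mD' := measurable_set_FT mD.
have DE w u : \1_D (w, u) = \1_(A `&` pos) w * \1_V (w, u) :> R.
  rewrite !indicE.
  have -> : ((w, u) \in D) = (w \in A `&` pos) && ((w, u) \in V).
    by apply/idP/andP; rewrite !inE => -[].
  by do 2 case: (_ \in _); rewrite ?mulr1 ?mulr0 ?mul0r.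
have iDX : (P \x eta)%E.-integrable setT (fun z => (\1_D z * X z)%:E).
  exact: integrable_indicM.
transitivity (\int[P \x eta]_z (\1_D z * X z)%:E)%E.
  rewrite -integral12_prod_meas1//.
  apply: ae_eq_integral => //.
  - exact: (measurable_int P (integrable_indicM mAp iQ)).
  - exact: (measurable_fubini_F iDX).
  apply: filterS2 QFq (ae_integrable1 iVX) => w HQ iVXw _; rewrite /fubini_F.
  rewrite EFinM -HQ /Fq -integralZl//.
  by apply: eq_integral => u _; rewrite DE -EFinM mulrA.
rewrite -integral_claim//.
have mclaim : measurable_fun setT (fun w => Y w (tau w)).
  by apply/measurable_EFinP; exact: measurable_int integrable_claim.
apply: ae_eq_integral => //.
- apply/measurable_EFinP; apply: measurable_funM => //.
  by apply: (measurable_at_tau FTM mtau); exact: measurable_indic.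
- by apply/measurable_EFinP; do 2 (apply: measurable_funM => //).
apply: filterS survival_gt0 => w Sw _; congr (_%:E).
have -> : \1_D (w, tau w) = \1_A w * \1_surv w :> R.
  rewrite DE !indicE in_setI.
  have -> : ((w, tau w) \in V) = (w \in surv) by apply/idP/idP; rewrite !inE.
  have [ws|ws] := boolP (w \in surv); last by rewrite !mulr0.
  have -> : w \in pos by rewrite inE; apply: Sw; move: ws; rewrite inE.
  by rewrite andbT.
by rewrite mulrA.
Qed.

End before_default.

Section condexp_claim.
Variable Yad : Omega -> R -> R.
Hypothesis HYad : is_after_default P F eta alpha T t Y Yad.

Local Notation Gt := (enlargedG F tau t).
Local Notation OmGt := (g_sigma_algebraType Gt).

Definition claim_version : Omega -> R := fun w =>
  \1_[set w | t < tau w] w * before_version w +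
  \1_[set w | tau w <= t] w * Yad w (tau w).

Let sG : is_subsigma Gt. Proof. exact: is_subsigma_enlargedG. Qed.

Let mGt A : measurable (A : set OmGt) <-> Gt A.
Proof. by apply: measurable_g_sigmaP; case: sG. Qed.

Let FtG : F t `<=` (@measurable _ OmGt).
Proof. by move=> A FA; apply/mGt; exact: sub_enlargedG. Qed.

Let mdefault : measurable ([set w | tau w <= t] : set OmGt).
Proof. by apply/mGt; exact: default_event_enlargedG. Qed.

Let msurvival : measurable ([set w | t < tau w] : set OmGt).
Proof.
have := measurableC mdefault; congr measurable; apply/seteqP.
by split => w /=; rewrite ltNge => /negP.
Qed.

Let mdefault' : measurable [set w | tau w <= t].
Proof. by case: sG => _; apply; exact/mGt. Qed.

Let msurvival' : measurable [set w | t < tau w].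
Proof. by case: sG => _; apply; exact/mGt. Qed.

(** On {tau <= t}, tau may be replaced by min(tau, t), which G_t knows. *)
Lemma measurable_claim_version : measurable_fun setT (claim_version : OmGt -> R).
Proof.
apply: measurable_funD.
  apply: measurable_funM; first exact: measurable_indic.
  exact: (@coarser_measurable_fun _ OmGt (F t) _ _ _ FtG measurable_before_version).
rewrite [X in measurable_fun _ X](_ : _ = fun w =>
  \1_[set w | tau w <= t] w *
    extend0 Yad (w, Num.min (tau w) t)); last first.
  apply/funext => w; rewrite indicE; have [|_] := boolP (w \in _).
    rewrite inE /= => wt.
    by rewrite (min_idPl wt) extend0E// ltW.
  by rewrite !mul0r.
apply: measurable_funM; first exact: measurable_indic.
have mp : measurable_fun setT
    (fun w : OmGt => ((w : OmFt), Num.min (tau w) t)).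
  apply/measurable_fun_pairP; split.
    exact: (@measurable_coarser _ OmGt (F t) FtG).
  exact: measurable_stopped_enlargedG.
have mYad : measurable_fun setT (extend0 Yad : OmFt * R -> R).
  by case: HYad => /measurable_extend0.
exact: (measurableT_comp mYad mp).
Qed.

Theorem is_condexp_claim :
  is_condexp P Gt (fun w => Y w (tau w)) claim_version.
Proof.
have iA := integrable_after HYad.
have iB := integrable_before.
have iA1 : P.-integrable setT
    (fun w => (\1_[set w | tau w <= t] w * Yad w (tau w))%:E).
  exact: (@integrable_indicM _ _ _ P _ (fun w => Yad w (tau w))).
split.
- exact: integrable_claim.
- exact: measurable_claim_version.
- exact: (integrableD measurableT iB iA1).
move=> B GB; have mB : measurable B by case: sG => _; exact.
have [D [A [mD FA DA]]] := enlargedG_trace filF t0 GB.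
have mA := FtM FA.
pose D' := D `&` [set z | z.2 <= t].
have mD' : measurable (D' : set (OmFt * R)).
  apply: measurableI => //.
  have := @measurable_snd _ _ OmFt R measurableT _ (measurable_itv `]-oo, t]).
  by rewrite setTI; congr measurable; apply/seteqP; split => z /=; rewrite in_itv.
have mDtau : measurable (fun w => D' (w, tau w)).
  have := measurable_at_tau FtM mtau (@measurable_indic _ _ R setT _ mD').
  move/(_ measurableT _ (measurable_set1 1)); rewrite setTI.
  congr measurable; apply/seteqP; split => w /=.
    by rewrite indicE => /eqP; rewrite pnatr_eq1 eqb1 inE.
  by move=> Dw; rewrite indicE mem_set.
(* On B the two parts are tested by A and by (., tau) in D' respectively. *)
have split_ind (f1 f2 : Omega -> R) w :
    \1_B w * (\1_[set w | t < tau w] w * f1 w + \1_[set w | tau w <= t] w * f2 w) =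
    \1_A w * (\1_[set w | t < tau w] w * f1 w) + \1_D' (w, tau w) * f2 w.
  have [wD wA] := DA w.
  have svE : (w \in [set w | t < tau w]) = (t < tau w).
    by apply/idP/idP; rewrite inE.
  have dfE : (w \in [set w | tau w <= t]) = (tau w <= t).
    by apply/idP/idP; rewrite inE.
  rewrite !indicE svE dfE /D' in_setI.
  have -> : ((w, tau w) \in [set z : Omega * R | z.2 <= t]) = (tau w <= t).
    by apply/idP/idP; rewrite inE.
  have [tw|wt] := leP (tau w) t.
    have -> : (w \in B) = ((w, tau w) \in D).
      by apply/idP/idP; rewrite !inE; apply wD.
    by rewrite andbT !mul0r mulr0 !add0r mul1r.
  have -> : (w \in B) = (w \in A).
    by apply/idP/idP; rewrite !inE; apply wA.
  by rewrite andbF !mul0r !addr0.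
have mclaim : P.-integrable setT (EFin \o (fun w => Y w (tau w))).
  exact: integrable_claim.
have iD (f : Omega -> R) : P.-integrable setT (EFin \o f) ->
    P.-integrable setT (fun w => (\1_D' (w, tau w) * f w)%:E).
  move=> intf.
  rewrite (_ : (fun w => _) = fun w =>
      (\1_(fun w' => D' (w', tau w')) w * f w)%:E); last first.
    by apply/funext => w; rewrite !indicE.
  exact: integrable_indicM.
rewrite -[LHS]integral_indicM -[RHS]integral_indicM /claim_version.
under eq_integral do rewrite (split_ind before_version (fun w => Yad w (tau w))).
rewrite (@integralD_EFin _ _ _ P _ measurableT
  (fun w => \1_A w * (\1_[set w | t < tau w] w * before_version w))
  (fun w => \1_D' (w, tau w) * Yad w (tau w)))//; last 2 first.
- exact: (integrable_indicM mA iB).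
- exact: iD.
rewrite integral_before// (integral_after HYad mD').
have -> : (\int[P]_w (\1_B w * Y w (tau w))%:E = \int[P]_w
    (\1_A w * (\1_[set w | t < tau w] w * Y w (tau w)) +
     \1_D' (w, tau w) * Y w (tau w))%:E)%E.
  apply: eq_integral => w _.
  rewrite -(split_ind (fun w => Y w (tau w)) (fun w => Y w (tau w))) -mulrDl.
  congr (_ * _)%:E; rewrite -[LHS]mul1r; congr (_ * _).
  rewrite !indicE.
  have -> : (w \in [set w | t < tau w]) = ~~ (w \in [set w | tau w <= t]).
    by apply/idP/idP; rewrite notin_setE inE /= ltNge => /negP.
  by case: (_ \in _); rewrite ?add0r ?addr0.
rewrite (@integralD_EFin _ _ _ P _ measurableT
  (fun w => \1_A w * (\1_[set w | t < tau w] w * Y w (tau w)))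
  (fun w => \1_D' (w, tau w) * Y w (tau w)))//; last exact: iD.
apply: (integrable_indicM mA).
exact: (integrable_indicM msurvival' mclaim).
Qed.

End condexp_claim.

End default_model.

Theorem theorem3p1 (d : measure_display) (Omega : measurableType d)
    (R : realType) (P : probability Omega R)
    (F : R -> set (set Omega)) (tau : {RV P >-> R})
    (eta : {sigma_finite_measure set R -> \bar R})
    (alpha : R -> Omega -> R -> R) (T t : R) (Y : Omega -> R -> R) :
  usual_conditions P F ->
  (forall w, 0 < tau w) ->
  density_hypothesis P F tau eta alpha ->
  0 <= T ->
  jointly_measurable (F T) Y ->
  (exists C : R, forall w u, 0 <= u -> `|Y w u| <= C) ->
  0 <= t -> t <= T ->
  (exists Yad, is_after_default P F eta alpha T t Y Yad) /\
  forall (Ybd : Omega -> R) (Yad : Omega -> R -> R),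
    is_before_default P F tau eta alpha T t Y Ybd ->
    is_after_default P F eta alpha T t Y Yad ->
    {ae P, forall w,
      condexp P (enlargedG F tau t) (fun w' => Y w' (tau w')) w =
        Ybd w * \1_[set w' | t < tau w'] w +
        Yad w (tau w) * \1_[set w' | tau w' <= t] w}.
Proof.
move=> [filF _ _] tau0 dens T0 mY [C YC] t0 tT.
have mtau : measurable_fun setT (tau : Omega -> R) by [].
split; first exact: (exists_after_default filF mtau tau0 dens T0 mY YC t0).
move=> Ybd Yad Hbd Had.
have sG := is_subsigma_enlargedG filF t0 mtau.
have version := is_condexp_claim filF mtau tau0 dens T0 mY YC t0 tT Had.
have chosen := is_condexp_condexp sG
  (integrable_claim P filF mtau tau0 T0 mY YC).
have Spos := survival_gt0 P filF mtau t0.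
have := is_condexp_ae_eq sG chosen version.
apply: filterS3 Spos Hbd => w Sw Hw ->.
rewrite /claim_version !indicE.
have -> : (w \in [set w' | t < tau w']) = (t < tau w) by apply/idP/idP; rewrite inE.
rewrite [X in X + _]mulrC [X in _ + X]mulrC; congr (_ + _).
have [tw|_] := ltP t (tau w); last by rewrite !mulr0.
by rewrite (Hw (Sw tw)) /before_version /posinv Sw.
Qed.
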